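(* Let $\mathbf A$ be an irreducible Artin–Tits monoid. Then there exists at most one uniform measure on $\partial\mathbf A$.
   Context: Let $\Sigma$ be a finite non-empty set and $\ell:\Sigma\times\Sigma\to\{2,3,\dots\}\cup\{\infty\}$ a symmetric function. The Artin–Tits monoid $\mathbf A=\mathbf A(\Sigma,\ell)$ is the monoid presented by the generators $\Sigma$ and the relations $abab\cdots=baba\cdots$ (both alternating words of length $\ell(a,b)$) for all $a\neq b$ with $\ell(a,b)<\infty$. Its unit is $\mathbf e$, and $|x|$ is the length of any word representing $x$. Put $x\leq_{\mathrm l}y$ iff $y=x\cdot z$ for some $z\in\mathbf A$, and $x\leq_{\mathrm r}y$ iff $y=z\cdot x$ for some $z\in\mathbf A$ (both are partial orders). $\bigvee X$ denotes the least upper bound of $X$ for $\leq_{\mathrm l}$ when it exists, and $a\vee b=\bigvee\{a,b\}$. $\mathbf A$ is of spherical type if $\Delta:=\bigvee\Sigma$ exists. $\mathbf A$ is irreducible if it is not isomorphic to the direct product of two Artin–Tits monoids. A Garside subset of $\mathbf A$ is a subset containing $\Sigma$, closed under existing $\vee$ (if $a,b$ belong to it and $a\vee b$ exists in $\mathbf A$ then $a\vee b$ belongs to it), and downward closed under $\leq_{\mathrm r}$. There is a smallest Garside subset $\mathcal S$; it is finite and contains $\Sigma\cup\{\mathbf e\}$. For $x,y\in\mathcal S$ write $x\to y$ if $x=\bigvee\{\zeta\in\mathcal S:\zeta\leq_{\mathrm l}x\cdot y\}$. The boundary at infinity $\partial\mathbf A$ is the set of infinite sequences $\xi=(y_j)_{j\geq1}$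 of elements of $\mathcal S\setminus\{\mathbf e\}$ with $y_j\to y_{j+1}$ for all $j$, with the topology induced by the product topology and its Borel $\sigma$-algebra. For $x\in\mathbf A$, $\uparrow x=\{\xi=(y_j)_{j\geq1}\in\partial\mathbf A:\ x\leq_{\mathrm l}y_1\cdots y_j\text{ for some }j\geq1\}$. A finite measure $\nu$ on $\partial\mathbf A$ is multiplicative if $\nu(\uparrow x)>0$ and $\nu(\uparrow(x\cdot y))=\nu(\uparrow x)\nu(\uparrow y)$ for all $x,y\in\mathbf A$. If $\mathbf A$ is of spherical type, the degenerate multiplicative measure is the Dirac measure at $(\Delta,\Delta,\dots)$; every other multiplicative measure is non degenerate. A multiplicative measure $\nu$ is uniform if it is non degenerate and there is $p\in(0,+\infty)$ with $\nu(\uparrow x)=p^{|x|}$ for all $x\in\mathbf A$. *)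

(* Defs.v *)
From HB Require Import structures.
From mathcomp Require Import all_boot all_order all_algebra.
From mathcomp Require Import all_classical all_reals all_analysis.

Set Implicit Arguments.
Unset Strict Implicit.
Unset Printing Implicit Defensive.

Import Order.TTheory GRing.Theory Num.Theory.

Local Open Scope classical_set_scope.
Local Open Scope quotient_scope.
Local Open Scope ring_scope.

(* A label [l a b] is [Some n] for l(a,b) = n and [None] for l(a,b) = oo; the
   values on the diagonal play no role in the presentation. *)
Definition artin_tits_label (Sigma : finType)
    (l : Sigma -> Sigma -> option nat) : Prop :=
  (forall a b, l a b = l b a) /\
  (forall a b n, l a b = Some n -> (2 <= n)%N).

(* a b a b ..., of length n *)
Definition alternating (T : Type) (n : nat) (a b : T) : seq T :=
  mkseq (fun i => if odd i then b else a) n.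

Section Monoid.
Variables (Sigma : finType) (l : Sigma -> Sigma -> option nat).

Inductive braid_congr : seq Sigma -> seq Sigma -> Prop :=
| braid_refl u : braid_congr u u
| braid_sym u v : braid_congr u v -> braid_congr v u
| braid_trans u v w : braid_congr u v -> braid_congr v w -> braid_congr u w
| braid_step u v a b n : a != b -> l a b = Some n ->
    braid_congr (u ++ alternating n a b ++ v) (u ++ alternating n b a ++ v).

Definition braid_rel : rel (seq Sigma) := fun u v => `[< braid_congr u v >].

Lemma braid_rel_refl : reflexive braid_rel.
Proof. by move=> u; apply/asboolP; exact: braid_refl. Qed.

Lemma braid_rel_sym : symmetric braid_rel.
Proof. by move=> u v; apply/asboolP/asboolP; exact: braid_sym. Qed.

Lemma braid_rel_trans : transitive braid_rel.
Proof.
by move=> v u w /asboolP uv /asboolP vw; apply/asboolP; exact: braid_trans vw.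
Qed.

Canonical braid_equiv :=
  EquivRel braid_rel braid_rel_refl braid_rel_sym braid_rel_trans.

Definition artin_tits : Type := {eq_quot braid_equiv}.

HB.instance Definition _ := Choice.on artin_tits.
HB.instance Definition _ := Quotient.on artin_tits.

Implicit Types (x y z : artin_tits) (u v w : seq Sigma).

Lemma artin_tits_eqP u v :
  \pi_artin_tits u = \pi_artin_tits v <-> braid_congr u v.
Proof.
split=> [/eqmodP/asboolP //|uv]; exact/eqmodP/asboolP.
Qed.

Lemma braid_congr_cat u v u' v' :
  braid_congr u u' -> braid_congr v v' -> braid_congr (u ++ v) (u' ++ v').
Proof.
move=> uu' vv'; apply: (@braid_trans _ (u' ++ v)).
  elim: uu' => {u u'} [u|u u' _|u w u' _ IH1 _ IH2|u w a b n ab lab].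
  - exact: braid_refl.
  - exact: braid_sym.
  - exact: braid_trans IH2.
  - by rewrite -!catA; exact: braid_step.
elim: vv' => {v v'} [v|v v' _|v w v' _ IH1 _ IH2|v w a b n ab lab].
- exact: braid_refl.
- exact: braid_sym.
- exact: braid_trans IH2.
- by rewrite !(catA u'); exact: braid_step.
Qed.

Definition at_one : artin_tits := \pi_artin_tits [::].
Definition at_mul x y : artin_tits := \pi_artin_tits (repr x ++ repr y).

Lemma repr_pi_congr u : braid_congr (repr (\pi_artin_tits u)) u.
Proof. by apply/artin_tits_eqP; rewrite reprK. Qed.

Lemma at_mul_pi u v :
  at_mul (\pi_artin_tits u) (\pi_artin_tits v) = \pi_artin_tits (u ++ v).
Proof. by apply/artin_tits_eqP/braid_congr_cat; exact: repr_pi_congr. Qed.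

Lemma at_mulA : associative at_mul.
Proof.
move=> x y z; apply/artin_tits_eqP.
apply: (@braid_trans _ (repr x ++ repr y ++ repr z)).
  by apply: braid_congr_cat; [exact: braid_refl|exact: repr_pi_congr].
rewrite catA; apply/braid_congr_cat; last exact: braid_refl.
exact/braid_sym/repr_pi_congr.
Qed.

Lemma at_1mul : left_id at_one at_mul.
Proof. by move=> x; rewrite -[x]reprK at_mul_pi. Qed.

Lemma at_mul1 : right_id at_one at_mul.
Proof. by move=> x; rewrite -[x]reprK at_mul_pi cats0. Qed.

HB.instance Definition _ :=
  isMonoid.Build artin_tits at_mulA at_1mul at_mul1.

Definition at_gen (a : Sigma) : artin_tits := \pi_artin_tits [:: a].

Definition at_length x : nat := size (repr x).

Lemma braid_congr_size u v : braid_congr u v -> size u = size v.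
Proof.
elim=> // [{}u {}v w _ -> _ -> //|{}u {}v a b n _ _].
by rewrite !size_cat !size_mkseq.
Qed.

Lemma at_length_pi w : at_length (\pi_artin_tits w) = size w.
Proof. exact/braid_congr_size/repr_pi_congr. Qed.

Definition le_l x y : Prop := exists z, y = (x * z)%g.
Definition le_r x y : Prop := exists z, y = (z * x)%g.

(* m = \/ X for le_l *)
Definition is_join (X : set artin_tits) (m : artin_tits) : Prop :=
  (forall x, X x -> le_l x m) /\
  (forall m', (forall x, X x -> le_l x m') -> le_l m m').

Definition is_delta (d : artin_tits) : Prop := is_join (range at_gen) d.

Definition garside (G : set artin_tits) : Prop :=
  [/\ forall a, G (at_gen a),
      forall x y m, G x -> G y -> is_join [set x; y] m -> G m &
      forall x y, G y -> le_r x y -> G x].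

Definition smallest_garside : set artin_tits := \bigcap_(G in garside) G.

Lemma smallest_garside_garside : garside smallest_garside.
Proof.
split=> [a G [] //|x y m Sx Sy xym G gG|x y Sy xy G gG].
- by case: (gG) => _ + _; apply; [exact: Sx|exact: Sy|].
- by case: (gG) => _ _; apply; [exact: Sy|].
Qed.

Definition arrow x y : Prop :=
  is_join [set zeta | smallest_garside zeta /\ le_l zeta (x * y)%g] x.

(* The sequence (y_j)_(j >= 1) is indexed from 0: y_(j+1) is [xi j]. *)
Definition boundary_set : set {ptws nat -> discrete_topology artin_tits} :=
  [set xi : nat -> artin_tits |
    (forall j, smallest_garside (xi j) /\ xi j <> 1%g) /\
    (forall j, arrow (xi j) (xi j.+1))].

(* [set_type] carries the topology induced by the product topology. *)
Definition boundary : Type := set_type boundary_set.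
HB.instance Definition _ := Topological.on boundary.

Definition boundary_seq (xi : boundary) : nat -> artin_tits := \val xi.

Definition up x : set boundary :=
  [set xi | exists2 j, (1 <= j)%N & le_l x (\prod_(i < j) boundary_seq xi i)%g].

(* Measurable types have to be pointed, hence the base point [x0]; neither the
   topology nor the Borel sets depend on it. It excludes no multiplicative
   measure, since such a measure gives positive mass to the whole boundary. *)
Definition boundary_at (x0 : boundary) : Type := boundary.
HB.instance Definition _ (x0 : boundary) := Topological.on (boundary_at x0).
HB.instance Definition _ (x0 : boundary) := isPointed.Build (boundary_at x0) x0.

Definition borel_boundary (x0 : boundary) : Type :=
  g_sigma_algebraType (@open (boundary_at x0)).
HB.instance Definition _ (x0 : boundary) := Measurable.on (borel_boundary x0).

End Monoid.

Definition irreducible_artin_tits (Sigma : finType)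
    (l : Sigma -> Sigma -> option nat) : Prop :=
  ~ exists (S1 S2 : finType)
      (l1 : S1 -> S1 -> option nat) (l2 : S2 -> S2 -> option nat)
      (f : {multiplicative artin_tits l -> artin_tits l1 * artin_tits l2}),
      [/\ (0 < #|S1|)%N /\ artin_tits_label l1,
          (0 < #|S2|)%N /\ artin_tits_label l2,
          f 1%g = 1%g &
          bijective f].

Section Measures.
Variables (Sigma : finType) (l : Sigma -> Sigma -> option nat).
Variables (R : realType) (x0 : boundary l).
Implicit Type nu : {finite_measure set (borel_boundary x0) -> \bar R}.

Local Open Scope ereal_scope.

Definition multiplicative_measure nu : Prop :=
  (forall x : artin_tits l, 0 < nu (up x)) /\
  (forall x y : artin_tits l, nu (up (x * y)%g) = nu (up x) * nu (up y)).

(* [nu] is the Dirac measure at (Delta, Delta, ...) *)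
Definition degenerate nu : Prop :=
  exists (d : artin_tits l) (xi : borel_boundary x0),
    [/\ is_delta d, (forall j, boundary_seq xi j = d) &
        forall B : set (borel_boundary x0), measurable B -> nu B = \d_xi B].

Definition uniform_measure nu : Prop :=
  [/\ multiplicative_measure nu, ~ degenerate nu &
      exists2 p : R, (0 < p)%R &
        forall x : artin_tits l, nu (up x) = (p ^+ at_length x)%:E].

End Measures.

(* Main.v *)
From HB Require Import structures.
Require Import Defs.
From mathcomp Require Import all_boot all_order all_algebra.
From mathcomp Require Import all_classical all_reals all_analysis.
From mathcomp Require Import ring lra zify.

(** A uniform measure of parameter [p] is determined by [p]. Indeed [up x] and
    [up y] meet in [up q] when [x] and [y] have a least common multiple [q], and
    are disjoint otherwise, so that these sets form a pi-system; and they generate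
    the Borel sets, because each entry of a boundary point is the largest simple
    element that can follow the preceding entries ([eq_measure_up]). It remains to
    see that two uniform measures have the same parameter.

    Call an element reduced when no shorter positive word has the same image in
    the Coxeter group. Factors and least common multiples of reduced elements are
    reduced. For [w] reduced, let [follow w] be the set of letters [a] such that
    [w * a] is reduced. The points whose largest reduced left divisor is [w] are
    those of [up w] that belong to no [up (w * a)] with [a] in [follow w]
    ([head_set]). Their mass is [p ^ |w| * g (follow w)], where [g T] denotes the
    mass of the points that have no first letter in [T]. Summing over [w] gives
      [g T = \sum_w p ^ |w| * g (follow w)],
    where [w] runs over the reduced elements other than the unit that have no
    first letter in [T]. The unknowns are indexed by the finite set of all
    [T <> Sigma], and the coefficients increase strictly with [p]. Hence two
    parameters [p1 < p2] are impossible: evaluate the system at a set [T] where the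
    ratio of the masses [g1 T / g2 T] is maximal ([parameter_le]). To avoid infinite
    sums, the system is used as two inequalities, one for each measure
    ([sum_heads_le] and [avoid_le_sum]).

    The comparison requires [g2 T > 0] for all [T <> Sigma]
    ([mass_avoid_gt0]). Since the measure is not degenerate, [p < 1], and so this
    holds when [T] has one element. Write [K] for the complement of [T], and say
    that [K] is positive when [g T > 0]. If [K] is a minimal positive set,
    [d] is the least common multiple of its letters and [s] is not in [K], then the
    first letters of [s * d] are [s] and the letters of [K] that commute with [s],
    and they form again a positive set ([positive_slide]). Thinking of [K] as tokens
    on the vertices of the Coxeter graph, tokens slide along edges and merge when
    they meet. Irreducibility means that this graph is connected
    ([irreducible_connected]), so that all tokens can be merged into a single one,
    which can then be brought to any vertex.

    All this rests on cancellation and on the existence of least common multiples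
    of elements that have a common multiple. Both follow from Garside's reduction
    lemma ([all_confluent]), proved by induction on the length. In the critical
    case of three generators, the least common multiple of [c] with [a] and that of
    [c] with [b] are reduced, hence so is the least common multiple of the two; and
    for reduced elements the lemma is a statement about the Coxeter group
    ([red_confluent]). The latter is accessed through its geometric representation:
    Tits's induction on dihedral subgroups ([split_exists]) shows that all roots
    are positive or negative and that reduced words satisfy the exchange property
    and Matsumoto's theorem ([exchange], [matsumoto]). *)

Set Implicit Arguments.
Unset Strict Implicit.
Unset Printing Implicit Defensive.

Import Order.TTheory GRing.Theory Num.Theory numFieldNormedType.Exports.

Local Open Scope classical_set_scope.
Local Open Scope quotient_scope.
Local Open Scope ring_scope.

(** * Alternating words *)

Notation alt := Defs.alternating.

Section AlternatingWords.
Variable T : eqType.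
Implicit Types (a b : T) (n : nat).

Lemma altS n a b : alt n.+1 a b = a :: alt n b a.
Proof.
rewrite /alt /mkseq /= -[1%N]/(1 + 0)%N iotaDl -map_comp.
by congr cons; apply: eq_map => i /=; rewrite if_neg.
Qed.

Lemma altSr n a b : alt n.+1 a b = rcons (alt n a b) (if odd n then b else a).
Proof. by rewrite /alt /mkseq -addn1 iotaD map_cat add0n cats1. Qed.

Lemma size_alt n a b : size (alt n a b) = n.
Proof. exact: size_mkseq. Qed.

Lemma rev_alt n a b :
  rev (alt n a b) = if odd n then alt n a b else alt n b a.
Proof.
elim: n a b => [|n IH] a b //.
by rewrite {1}altS rev_cons IH oddS !altSr; case: (odd n).
Qed.

Lemma alt_cat n m a b : (n <= m)%N -> exists w, alt m a b = alt n a b ++ w.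
Proof.
elim: n m a b => [|n IH] [|m] a b // nm; [by exists [::]|by eexists|].
have [w ww] := IH m b a nm.
by exists w; rewrite !altS ww.
Qed.

Lemma all_alt (P : pred T) n a b : (1 < n)%N -> all P (alt n a b) = P a && P b.
Proof.
case: n => [|[|n]] // _; rewrite !altS /=.
case Pa: (P a) => //; case Pb: (P b) => //=.
by elim: n a b Pa Pb => // n IH a b Pa Pb; rewrite altS /= Pa IH.
Qed.

End AlternatingWords.

(** * Coordinates of the roots of a dihedral group *)

Section Chebyshev.
Variable R : realType.
Implicit Types (o : option nat) (m j : nat).

(** Minus twice the Gram coefficient of two simple roots with label [o]: with
    this value the product of the two reflections is a rotation of angle
    [2 * pi / m], or is unipotent when the label is infinite. *)
Definition cheb o : R := if o is Some m then 2 * cos (pi / m%:R) else 2.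

(** Chebyshev polynomials of the second kind at [cheb o / 2], with the index shifted
    by one; the roots of a dihedral group have two consecutive values as
    coordinates. *)
Definition chebU o j : R :=
  if o is Some m then sin (j%:R * (pi / m%:R)) / sin (pi / m%:R) else j%:R.

Lemma sin_angle_gt0 m : (2 <= m)%N -> 0 < sin (pi / m%:R) :> R.
Proof.
move=> m2; have m0 : (0 : R) < m%:R by rewrite ltr0n; lia.
apply: sin_gt0_pi; rewrite divr_gt0 ?pi_gt0 //= ltr_pdivrMr // ltr_pMr ?pi_gt0 //.
by rewrite ltr1n.
Qed.

Lemma chebU0 o : chebU o 0 = 0.
Proof. by case: o => [m|] //=; rewrite mul0r sin0 mul0r. Qed.

Lemma chebU1 o : (forall m, o = Some m -> (2 <= m)%N) -> chebU o 1 = 1.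
Proof.
case: o => [m|] //= /(_ m erefl) m2.
by rewrite mul1r divff // gt_eqF // sin_angle_gt0.
Qed.

Lemma chebUSS o j : chebU o j.+2 = cheb o * chebU o j.+1 - chebU o j.
Proof.
case: o => [m|] /=; last by rewrite -!natr1; ring.
set t := pi / m%:R; rewrite mulrA -mulrBl; congr (_ / _).
have -> : j.+2%:R * t = j.+1%:R * t + t by rewrite -[j.+2%:R]natr1 mulrDl mul1r.
have -> : j%:R * t = j.+1%:R * t - t by rewrite -[j.+1%:R]natr1; ring.
rewrite sinD sinB; ring.
Qed.

(** Up to index [m] the angles stay in the upper half-plane. This is what makes
    the first [m] roots produced by an alternating word positive. *)
Lemma chebU_ge0 o j : (forall m, o = Some m -> (2 <= m)%N /\ (j <= m)%N) ->
  0 <= chebU o j.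
Proof.
case: o => [m|] //= /(_ m erefl) [m2 jm].
have m0 : (0 : R) < m%:R by rewrite ltr0n; lia.
apply: divr_ge0; last exact/ltW/sin_angle_gt0.
rewrite le_eqVlt; apply/orP.
have [->|j0] := posnP j; first by left; rewrite mul0r sin0 eqxx.
move: jm; rewrite leq_eqVlt => /orP[/eqP->|jm].
  by left; rewrite mulrC divfK ?sinpi ?eqxx // gt_eqF.
right; apply: sin_gt0_pi; rewrite mulr_gt0 ?divr_gt0 ?pi_gt0 ?(ltr0n _ j) //=.
by rewrite mulrA ltr_pdivrMr // mulrC ltr_pM2l ?pi_gt0 // ltr_nat.
Qed.

Lemma angleK m : (2 <= m)%N -> m%:R * (pi / m%:R) = pi :> R.
Proof. by move=> m2; rewrite mulrC divfK // pnatr_eq0; lia. Qed.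

Lemma chebU_top m : (2 <= m)%N -> chebU (Some m) m = 0.
Proof. by move=> m2; rewrite /= angleK // sinpi mul0r. Qed.

Lemma chebU_topS m : (2 <= m)%N -> chebU (Some m) m.+1 = -1.
Proof.
move=> m2; rewrite /= -natr1 mulrDl mul1r angleK // addrC sinDpi.
by rewrite mulNr divff // gt_eqF // sin_angle_gt0.
Qed.

Lemma chebU_pred m : (2 <= m)%N -> chebU (Some m) m.-1 = 1.
Proof.
move=> m2; have := chebUSS (Some m) m.-1.
rewrite prednK; last by lia.
rewrite chebU_topS // chebU_top // mulr0 sub0r => /eqP.
by rewrite eqr_opp => /eqP <-.
Qed.

Lemma cheb_lt2 m : (2 <= m)%N -> 0 < 4 - cheb (Some m) ^+ 2.
Proof.
move=> m2; rewrite /cheb exprMn.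
have := cos2Dsin2 (pi / m%:R : R); have := sin_angle_gt0 m2.
move=> s0 e; have : 0 < sin (pi / m%:R : R) ^+ 2 by rewrite exprn_gt0.
by move: e; lra.
Qed.

End Chebyshev.

(** * The geometric representation of the Coxeter group *)

Section Roots.
Variables (R : realType) (Sigma : finType) (l : Sigma -> Sigma -> option nat).
Hypothesis l_label : artin_tits_label l.

Local Notation V := (Sigma -> R).
Implicit Types (a b c s t r : Sigma) (u v w : seq Sigma) (x y : V).
Local Notation "u ~~ v" := (braid_congr l u v) (at level 70).

Let lC a b : l a b = l b a. Proof. exact: l_label.1. Qed.
Let l2 a b n : l a b = Some n -> (2 <= n)%N. Proof. exact: l_label.2. Qed.

Definition kap a b : R := cheb R (l a b).

(** Vectors are given by their coordinates in the basis of simple roots; a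
    simple reflection changes a single coordinate. *)
Definition srefl a x : V :=
  fun r => if r == a then - x a + \sum_(b | b != a) kap a b * x b else x r.

Definition act u x : V := foldr srefl x u.

Definition alpha a : V := fun r => (r == a)%:R.

Definition nneg x := forall r, 0 <= x r.

Lemma act_cat u v x : act (u ++ v) x = act u (act v x).
Proof. exact: foldr_cat. Qed.

Lemma act_rcons u a x : act (rcons u a) x = act u (srefl a x).
Proof. by rewrite -cats1 act_cat. Qed.

Lemma sreflK a : involutive (srefl a).
Proof.
move=> x; apply/funext => r; rewrite /srefl /= eqxx; case: eqP => [->|//].
under [X in _ + X = _]eq_bigr => b /negPf -> do [].
by rewrite opprD opprK addrNK.
Qed.

Lemma act_revK u : cancel (act u) (act (rev u)).
Proof.
elim: u => [|a u IH] x //=.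
by rewrite rev_cons act_rcons sreflK IH.
Qed.

Lemma act_Krev u : cancel (act (rev u)) (act u).
Proof. by move=> x; rewrite -{1}[u]revK act_revK. Qed.

Lemma act_sum u x r : act u x r = \sum_b x b * act u (alpha b) r.
Proof.
elim: u r => [|a u IH] r /=.
  rewrite (bigD1 r) //= big1 ?addr0 /alpha ?eqxx ?mulr1 // => b br.
  by rewrite eq_sym (negPf br) mulr0.
rewrite /srefl; case: ifP => _; last exact: IH.
rewrite IH -sumrN.
under [X in _ + X = _]eq_bigr do rewrite IH mulr_sumr.
rewrite exchange_big -big_split /=; apply: eq_bigr => b _.
rewrite mulrDr mulr_sumr mulrN; congr (_ + _).
by apply: eq_bigr => c _; ring.
Qed.

Lemma act_lin u p q x y :
  act u (fun r => p * x r + q * y r) = (fun r => p * act u x r + q * act u y r).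
Proof.
apply/funext => r; rewrite act_sum (act_sum u x) (act_sum u y) !mulr_sumr.
by rewrite -big_split /=; apply: eq_bigr => b _; ring.
Qed.

Lemma actN u x : act u (fun r => - x r) = (fun r => - act u x r).
Proof.
apply/funext => r; rewrite act_sum (act_sum u x) -sumrN.
by apply: eq_bigr => b _; ring.
Qed.

Lemma srefl_alpha a : srefl a (alpha a) = (fun r => - alpha a r).
Proof.
apply/funext => r; rewrite /srefl /alpha eqxx; case: eqP => [_|_]; last by rewrite oppr0.
by rewrite big1 ?addr0 // => b /negPf ->; rewrite mulr0.
Qed.

Lemma nneg_alpha a : nneg (alpha a).
Proof. by move=> r; rewrite /alpha ler0n. Qed.

Lemma nnegD p q x y : 0 <= p -> 0 <= q -> nneg x -> nneg y ->
  nneg (fun r => p * x r + q * y r).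
Proof. by move=> p0 q0 x0 y0 r; rewrite addr_ge0 ?mulr_ge0. Qed.

(** Positive and negative roots are disjoint, because reflections are invertible
    and simple roots are not zero. *)
Lemma root_sign_unique u a :
  nneg (act u (alpha a)) -> nneg (fun r => - act u (alpha a) r) -> False.
Proof.
move=> h1 h2.
have e : act u (alpha a) = (fun r => - act u (alpha a) r).
  apply/funext => r; have /= := h1 r; have /= := h2 r; lra.
have := congr1 (act (rev u)) e; rewrite actN !act_revK => /(congr1 (@^~ a)).
by rewrite /alpha /= eqxx mulr1n => /eqP; rewrite eq_sym eqNr oner_eq0.
Qed.

(** An alternating word in [a] and [b] moves only the two coordinates at [a] and
    [b], by an affine dihedral group; [(ca, cb)] is a fixed point of this group,
    and around it the letters applied successively produce a sequence that
    satisfies the recurrence of [chebU]. The coordinates [z0] and [z1] are those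
    changed first and second, whence the parity of [j]. *)
Lemma act_alt_formula a b x (ca cb : R) j : a != b ->
  2 * ca = kap a b * cb + \sum_(r | (r != a) && (r != b)) kap a r * x r ->
  2 * cb = kap a b * ca + \sum_(r | (r != b) && (r != a)) kap b r * x r ->
  let U := chebU R (l a b) in
  let z0 := if odd j then x a - ca else x b - cb in
  let z1 := if odd j then x b - cb else x a - ca in
  act (alt j a b) x = (fun r =>
    if r == a then ca + U j.+1 * z1 - U j * z0
    else if r == b then
      cb + U j * z1 - (kap a b * U j - U j.+1) * z0
    else x r).
Proof.
move=> ab; elim: j a b ab ca cb => [|j IH] a b ab ca cb ha hb U.
  apply/funext => r /=.
  rewrite /U chebU0 chebU1; last by move=> m; exact: l2.
  by case: eqP => [->|_]; [ring|case: eqP => [->|_]; ring].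
have ba : b != a by rewrite eq_sym.
have kC : kap b a = kap a b by rewrite /kap lC.
have UC : chebU R (l b a) = U by rewrite /U lC.
rewrite altS /= (IH b a ba cb ca) ?kC // UC.
apply/funext => r; rewrite /srefl eqxx (negPf ab).
have -> : U j.+2 = kap a b * U j.+1 - U j by exact: chebUSS.
case: eqP => [_|_]; last first.
  case: eqP => [_|//]; rewrite /=; case: (odd j) => /=; ring.
rewrite (bigD1 b) //= eqxx.
under eq_bigr => i /andP[/negPf -> /negPf ->] do [].
have -> : \sum_(i | (i != a) && (i != b)) kap a i * x i = 2 * ca - kap a b * cb.
  by rewrite ha; ring.
case: (odd j) => /=; ring.
Qed.

(** After [m] steps [chebU] takes the values [0] and [-1], so that the formula of
    [act_alt_formula] is symmetric in [a] and [b]. The fixed point exists because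
    the Gram matrix of two roots with a finite label is invertible. *)
Lemma act_braid a b m : a != b -> l a b = Some m ->
  act (alt m a b) = act (alt m b a).
Proof.
move=> ab lab; apply/funext => x.
have m2 := l2 lab; have k4 := cheb_lt2 R m2.
have ba : b != a by rewrite eq_sym.
set ea := \sum_(r | (r != a) && (r != b)) kap a r * x r.
set eb := \sum_(r | (r != b) && (r != a)) kap b r * x r.
have kE : kap a b = cheb R (Some m) by rewrite /kap lab.
have kE' : kap b a = kap a b by rewrite /kap lC.
pose k := cheb R (Some m); have k0 : 4 - k ^+ 2 != 0 by rewrite gt_eqF.
pose ca := (2 * ea + k * eb) / (4 - k ^+ 2).
pose cb := (2 * eb + k * ea) / (4 - k ^+ 2).
have ha : 2 * ca = kap a b * cb + ea by rewrite kE /ca /cb -/k; field.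
have hb : 2 * cb = kap a b * ca + eb by rewrite kE /ca /cb -/k; field.
rewrite (act_alt_formula m ab ha hb).
rewrite (@act_alt_formula b a x cb ca m ba) ?kE' //.
apply/funext => r; rewrite (lC b a) lab.
rewrite chebU_top // chebU_topS //.
have [->|/eqP ra] := eqVneq r a.
  by rewrite (negPf ab); case: (odd m); ring.
by have [_|_] := eqVneq r b; case: (odd m); ring.
Qed.

Lemma act_braid_congr u v : u ~~ v -> act u = act v.
Proof.
elim=> // [{}u {}v w _ -> _ -> //|{}u {}v a b m ab lab].
by apply/funext => x; rewrite !act_cat (act_braid ab lab).
Qed.

Lemma braid_head a b m v : a != b -> l a b = Some m ->
  alt m a b ++ v ~~ alt m b a ++ v.
Proof. by move=> ab lab; exact: (@braid_step _ l [::] v a b m). Qed.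

Lemma braid_congr_rev u v : u ~~ v -> rev u ~~ rev v.
Proof.
elim=> [w|{}u {}v _|{}u {}v w _ h _|{}u {}v a b m ab lab].
- exact: braid_refl.
- exact: braid_sym.
- exact: braid_trans.
rewrite !rev_cat !rev_alt -!catA.
case: (odd m); first exact: braid_step.
by apply: braid_step; rewrite 1?eq_sym // lC.
Qed.

Lemma act_alt_alpha a b j : a != b ->
  act (alt j a b) (alpha (if odd j then b else a)) =
  (fun r => chebU R (l a b) j.+1 * alpha a r + chebU R (l a b) j * alpha b r).
Proof.
move=> ab; have ba : b != a by rewrite eq_sym.
rewrite (@act_alt_formula _ _ _ 0 0) //; first last.
- rewrite big1 ?mulr0 ?addr0 // => r /andP[rb ra].
  by rewrite /alpha; case: ifP => _; rewrite ?(negPf ra) ?(negPf rb) mulr0.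
- rewrite big1 ?mulr0 ?addr0 // => r /andP[ra rb].
  by rewrite /alpha; case: ifP => _; rewrite ?(negPf ra) ?(negPf rb) mulr0.
apply/funext => r; rewrite /alpha.
case: (eqVneq r a) => [ra|ra].
  rewrite ra (negPf ab).
  by case: (odd j); rewrite ?eqxx ?(negPf ab) ?(negPf ba) /=; ring.
case: (eqVneq r b) => [rb|rb].
  by case: (odd j); rewrite ?eqxx ?(negPf ab) ?(negPf ba) /=; ring.
by case: (odd j); rewrite ?(negPf ra) ?(negPf rb) /=; ring.
Qed.

(** The form in which [act_alt_alpha] is used: the root that the letter [a] adds
    in front of an alternating word that starts with [b]. *)
Lemma act_rev_alt_alpha a b j : a != b ->
  exists c d, [/\ c != d, (c = a /\ d = b) \/ (c = b /\ d = a),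
    l c d = l a b, d = (if odd j then a else b) &
  act (rev (alt j b a)) (alpha a) =
  (fun r => chebU R (l a b) j.+1 * alpha c r + chebU R (l a b) j * alpha d r)].
Proof.
move=> ab; have ba : b != a by rewrite eq_sym.
rewrite rev_alt; case oj: (odd j).
  exists b, a; split=> //; [by right|].
  by have := act_alt_alpha j ba; rewrite oj => ->; rewrite lC.
exists a, b; split=> //; [by left|].
by have := act_alt_alpha j ab; rewrite oj.
Qed.

(** Reduced words: every letter must add a positive root, where the root added by
    a letter is seen from the right end of the word. For the Coxeter group this
    says that the word is as short as possible, but this definition makes sense
    for positive words and mentions no length function. *)
Fixpoint redw u : Prop :=
  if u is a :: v then redw v /\ nneg (act (rev v) (alpha a)) else True.

Lemma redw_catr u v : redw (u ++ v) -> redw v.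
Proof. by elim: u => //= a u IH [/IH]. Qed.

Lemma redw_cat_eq u v w : redw w -> act (rev v) = act (rev w) ->
  redw (u ++ v) -> redw (u ++ w).
Proof.
move=> rw e'; elim: u => //= a u IH [/IH ? h]; split=> //.
by move: h; rewrite !rev_cat !act_cat e'.
Qed.

(** The roots added by an alternating word are nonnegative combinations of the
    images of the two simple roots, as long as it is not longer than the braid
    relation. *)
Lemma redw_alt a b j v : a != b -> (forall m, l a b = Some m -> (j <= m)%N) ->
  redw v -> nneg (act (rev v) (alpha a)) -> nneg (act (rev v) (alpha b)) ->
  redw (alt j a b ++ v).
Proof.
move=> ab jm rv na nb; elim: j a b ab jm na nb => [|j IH] a b ab jm na nb //.
have ba : b != a by rewrite eq_sym.
rewrite altS /=; split.
  by apply: IH => // m; rewrite lC => /jm /ltnW.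
rewrite rev_cat act_cat.
have [c [d [_ cd _ _ ->]]] := act_rev_alt_alpha j ab.
rewrite act_lin; apply: nnegD.
- by apply: chebU_ge0 => m lab; split; [exact: l2 lab|exact: jm].
- by apply: chebU_ge0 => m lab; split; [exact: l2 lab|apply/ltnW/jm].
- by case: cd => -[-> _].
- by case: cd => -[_ ->].
Qed.

(** Conversely, the first and the last letters of a braid word add the images of
    the two simple roots themselves. Together with [redw_alt] this describes
    reducedness of a braid word in terms symmetric in its two letters. *)
Lemma redw_alt_nneg a b m v : a != b -> l a b = Some m ->
  redw (alt m a b ++ v) ->
  [/\ redw v, nneg (act (rev v) (alpha a)) & nneg (act (rev v) (alpha b))].
Proof.
move=> ab lab h; have m2 := l2 lab.
have [k mk] : exists k, m = k.+1 by exists m.-1; lia.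
have ba : b != a by rewrite eq_sym.
have rv := redw_catr h.
have hlast : nneg (act (rev v) (alpha (if odd k then b else a))).
  by move: h; rewrite mk altSr cat_rcons => /redw_catr [].
have hfst : nneg (act (rev v) (alpha (if odd k then a else b))).
  move: h; rewrite mk altS /= => -[_]; rewrite rev_cat act_cat.
  have [c [d [_ _ _ <- ->]]] := act_rev_alt_alpha k ab.
  have km : chebU R (Some m) k = 1 by rewrite -(chebU_pred R m2) mk.
  rewrite act_lin lab -mk chebU_top // km => h r.
  by have := h r; rewrite mul0r mul1r add0r.
by split=> //; move: hlast hfst; case: (odd k).
Qed.

Lemma redw_congr u v : u ~~ v -> redw u <-> redw v.
Proof.
elim=> // [w z _ [h1 h2]|w z t _ h1 _ h2|{}u {}v a b m ab lab].
- by split.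
- exact: (iff_trans h1 h2).
have ba : b != a by rewrite eq_sym.
have lba : l b a = Some m by rewrite lC.
have aux (c d : Sigma) : c != d -> l c d = Some m ->
    redw (u ++ alt m c d ++ v) -> redw (u ++ alt m d c ++ v).
  move=> cd lcd; have dc : d != c by rewrite eq_sym.
  move=> h; have h' := redw_catr h.
  apply: redw_cat_eq h => //.
  - have [rv nc nd] := redw_alt_nneg cd lcd h'.
    by apply: redw_alt => // n; rewrite lC lcd => -[<-].
  - apply/act_braid_congr/braid_congr_rev.
    exact: braid_head.
by split; exact: aux.
Qed.

End Roots.

(** * Reduced words: exchange and Matsumoto's theorem *)

Section Reduced.
Variables (R : realType) (Sigma : finType) (l : Sigma -> Sigma -> option nat).
Hypothesis l_label : artin_tits_label l.

Implicit Types (a b c s t : Sigma) (u v w : seq Sigma).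
Local Notation "u ~~ v" := (braid_congr l u v) (at level 70).
Local Notation act := (@act R Sigma l).
Local Notation alpha := (@alpha R Sigma).
Local Notation redw := (redw R l).

Let lC a b : l a b = l b a. Proof. exact: l_label.1. Qed.

Lemma act_rev_cons_alpha a u :
  act (rev (a :: u)) (alpha a) = (fun r => - act (rev u) (alpha a) r).
Proof. by rewrite rev_cons act_rcons srefl_alpha actN. Qed.

Lemma redw_sq a u : ~ redw (a :: a :: u).
Proof.
move=> [[_ h1] h2]; apply: (root_sign_unique h1).
by move: h2; rewrite act_rev_cons_alpha.
Qed.

(** The word [v] is a shortest representative of the coset of [u] modulo the
    dihedral subgroup of [s] and [t]. *)
Definition dihedral_split u s t := exists j a b v,
  [/\ (a = s /\ b = t) \/ (a = t /\ b = s), u ~~ alt j a b ++ v,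
      nneg (act (rev v) (alpha s)) & nneg (act (rev v) (alpha t))].

(** Splitting off the dihedral part reduces the exchange property to the dihedral
    group: there, either the alternating word is short and the new root is a
    nonnegative combination of two positive roots, or it contains the full braid
    word, which may also start with [s]. *)
Lemma split_exchange u s t :
  s != t -> redw (t :: u) -> dihedral_split u s t ->
  nneg (act (rev (t :: u)) (alpha s)) \/ exists v, t :: u ~~ s :: v.
Proof.
move=> st ru [j [a [b [v [ab uv ns nt]]]]].
have tuv : t :: u ~~ t :: alt j a b ++ v.
  by apply: (@braid_congr_cat _ _ [:: t] _ [:: t] _ _ uv); exact: braid_refl.
have {tuv} tuv : t :: u ~~ alt j.+1 t s ++ v.
  case: ab => -[aE bE]; first by move: tuv; rewrite altS aE bE.
  move: tuv; case: j {uv} => [|j]; first by rewrite altS.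
  rewrite altS aE => tuv.
  by have := (redw_congr R l_label tuv).1 ru; move/redw_sq.
have ts : t != s by rewrite eq_sym.
case lm: (l t s) => [m|]; last first.
  left; rewrite (act_braid_congr _ l_label (braid_congr_rev l_label tuv)).
  rewrite rev_cat act_cat.
  have [c [d [_ cd _ _ ->]]] := act_rev_alt_alpha R l_label j.+1 st.
  have lst : l s t = None by rewrite lC.
  rewrite act_lin; apply: nnegD; try by apply: chebU_ge0; rewrite lst.
  - by case: cd => -[-> _].
  - by case: cd => -[_ ->].
have [mj|jm] := leqP m j.+1.
  right; have [w ww] := alt_cat t s mj.
  have m2 := l_label.2 _ _ _ lm.
  case: m m2 lm mj ww => // m _ lm mj ww.
  exists (alt m t s ++ w ++ v); apply: braid_trans tuv _.
  have -> : s :: alt m t s ++ w ++ v = alt m.+1 s t ++ (w ++ v) by rewrite altS.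
  by rewrite ww -catA; exact: braid_head.
left; rewrite (act_braid_congr _ l_label (braid_congr_rev l_label tuv)).
rewrite rev_cat act_cat.
have [c [d [_ cd _ _ ->]]] := act_rev_alt_alpha R l_label j.+1 st.
have lst : l s t = Some m by rewrite lC.
have m2 := l_label.2 _ _ _ lm.
rewrite act_lin; apply: nnegD.
- by apply: chebU_ge0; rewrite lst => _ [<-].
- by apply: chebU_ge0; rewrite lst => _ [<-]; split=> //; apply: ltnW.
- by case: cd => -[-> _].
- by case: cd => -[_ ->].
Qed.

(** The induction of Tits: exchange in length [n.+1] follows from dihedral
    splittings in length [n], and splitting in length [n.+1] uses exchange to
    peel off one letter. *)
Lemma split_exists u s t : redw u -> s != t -> dihedral_split u s t.
Proof.
move: {2}(size u) (leqnn (size u)) => n.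
elim: n u s t => [|n IH] u s t un ru st.
  case: u un ru => // _ _; exists 0%N, s, t, [::].
  split; [by left|exact: braid_refl|exact: nneg_alpha|exact: nneg_alpha].
have exch c : nneg (act (rev u) (alpha c)) \/ exists v, u ~~ c :: v.
  case: u un ru => [|d u] un ru; first by left; exact: nneg_alpha.
  have [->|cd] := eqVneq c d; first by right; exists u; exact: braid_refl.
  by apply: split_exchange => //; exact: (IH u c d un ru.1 cd).
have done c d v : u ~~ c :: v -> (c = s /\ d = t) \/ (c = t /\ d = s) ->
    dihedral_split u s t.
  move=> uv cd.
  have rcv := (redw_congr R l_label uv).1 ru.
  have vn : (size v <= n)%N by have := braid_congr_size uv; move: un => /=; lia.
  have [j [a [b [w [ab vw ns nt]]]]] := IH v s t vn rcv.1 st.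
  have uw : u ~~ c :: alt j a b ++ w.
    apply: braid_trans uv _.
    by apply: (@braid_congr_cat _ _ [:: c] _ [:: c] _ _ vw); exact: braid_refl.
  exists j.+1, c, d, w; split=> //.
  have [ac|ac] := eqVneq a c.
    case: j {vw} uw => [|j]; first by rewrite altS.
    rewrite altS ac => uw.
    by have := (redw_congr R l_label uw).1 ru; move/redw_sq.
  have [da bc] : d = a /\ b = c.
    by case: ab ac => -[-> ->]; case: cd => -[-> ->] //; rewrite eqxx.
  by move: uw; rewrite altS da bc.
have [ns|[v uv]] := exch s; last by apply: (done s t v uv); left.
have [nt|[v uv]] := exch t; last by apply: (done t s v uv); right.
by exists 0%N, s, t, u; split=> //; by [left|exact: braid_refl].
Qed.

(** The dichotomy at the level of the monoid: a letter either adds a positive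
    root in front of a reduced word, or is already a first letter up to braid
    relations. *)
Lemma exchange u s : redw u ->
  nneg (act (rev u) (alpha s)) \/ exists v, u ~~ s :: v.
Proof.
case: u => [|t u] ru; first by left; exact: nneg_alpha.
have [->|st] := eqVneq s t; first by right; exists u; exact: braid_refl.
by apply: split_exchange => //; apply: split_exists => //; case: ru.
Qed.

Lemma exists_redw u : exists v, [/\ redw v, act u = act v & act (rev u) = act (rev v)].
Proof.
elim: u => [|a u [v [rv uv uv']]]; first by exists [::].
case: (exchange a rv) => [na|[w vw]].
  exists (a :: v); split=> //; apply/funext => x; rewrite ?rev_cons ?act_rcons /=.
    by rewrite uv.
  by rewrite uv'.
exists w; split.
- by have [] := (redw_congr R l_label vw).1 rv.
- apply/funext => x /=; rewrite uv (act_braid_congr _ l_label vw) /=.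
  by rewrite sreflK.
- apply/funext => x; rewrite rev_cons act_rcons uv'.
  rewrite (act_braid_congr _ l_label (braid_congr_rev l_label vw)).
  by rewrite rev_cons act_rcons sreflK.
Qed.

Lemma root_sign u s : nneg (act (rev u) (alpha s)) \/
  nneg (fun r => - act (rev u) (alpha s) r).
Proof.
have [v [rv _ ->]] := exists_redw u.
case: (exchange s rv) => [?|[w vw]]; [by left|right].
have [rw nw] := (redw_congr R l_label vw).1 rv.
rewrite (act_braid_congr _ l_label (braid_congr_rev l_label vw)).
by rewrite act_rev_cons_alpha => r; rewrite opprK.
Qed.

Lemma redw_rcons w s :
  redw w -> (forall w1 a w2, w = w1 ++ a :: w2 ->
    nneg (act (rev (rcons w2 s)) (alpha a))) -> redw (rcons w s).
Proof.
elim: w => [|b w IH] /=; first by move=> _ _; split=> //; exact: nneg_alpha.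
move=> [rw nb] h; split; last exact: (h [::] b w).
by apply: IH => // w1 a w2 ww; apply: (h (b :: w1)); rewrite ww.
Qed.

(** Reducedness does not depend on the side from which the roots are seen. If
    putting [s] in front of [u] made a positive root of [u] negative, this root
    would be proportional to the simple root of [s]; evaluating [u] on it shows
    that [s] adds a negative root in front of [u]. *)
Lemma redw_rev u : redw u -> redw (rev u).
Proof.
elim: u => // s u IH /= [ru ns]; have rw := IH ru.
rewrite rev_cons; apply: redw_rcons => // w1 a w2 ww.
have := root_sign (rcons w2 s) a; case=> // np; exfalso.
have nb : nneg (act (rev w2) (alpha a)).
  by move: rw; rewrite ww => /redw_catr [].
move: np; rewrite rev_rcons /=; set be := act _ _ in nb * => np.
(* a simple reflection changes one coordinate, so a nonnegative vector that it
   makes nonpositive is a multiple of the simple root *)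
have beE : be = (fun r => be s * alpha s r).
  apply/funext => r; rewrite /alpha; have [->|/negPf rs] := eqVneq r s.
    by rewrite mulr1.
  rewrite mulr0; have := np r; have := nb r; rewrite /srefl rs; lra.
have uw : u = rev w2 ++ a :: rev w1.
  by rewrite -[u]revK ww rev_cat rev_cons cat_rcons.
have n1 : nneg (act w1 (alpha a)).
  by move: ru; rewrite uw => /redw_catr [_]; rewrite revK.
apply: (root_sign_unique n1) => r.
have e : act (rev u) be = (fun r => - act w1 (alpha a) r).
  by rewrite uw -rev_rcons -rev_cat revK cat_rcons act_cat /= act_Krev srefl_alpha actN.
have <- := congr1 (@^~ r) e; rewrite beE.
have -> : act (rev u) (fun r => be s * alpha s r) =
    (fun r => be s * act (rev u) (alpha s) r + 0 * act (rev u) (alpha s) r).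
  rewrite -act_lin; congr act; apply/funext => q; by rewrite mul0r addr0.
by rewrite mul0r addr0 mulr_ge0.
Qed.

(** Matsumoto's theorem: a first letter of [u] is recognized on the action, hence
    it is also a first letter of [v] by [exchange]. *)
Lemma matsumoto u v : redw u -> redw v ->
  act (rev u) = act (rev v) -> u ~~ v.
Proof.
elim: u v => [|s u IH] v.
  case: v => [|t v] _; first by move=> *; exact: braid_refl.
  move=> [rv nt] e; exfalso; apply: (root_sign_unique nt).
  by have := nneg_alpha R t; have /= := congr1 (@^~ (alpha t)) e;
    rewrite act_rev_cons_alpha => <-.
move=> [ru ns] rv e.
have [nv|[w vw]] := exchange s rv.
  exfalso; apply: (root_sign_unique ns).
  by rewrite -act_rev_cons_alpha e.
have [rw nw] := (redw_congr R l_label vw).1 rv.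
apply: braid_trans (braid_sym vw).
apply: (@braid_congr_cat _ _ [:: s] _ [:: s]); first exact: braid_refl.
apply: IH => //; apply/funext => x.
have := congr1 (@^~ (srefl l s x)) e.
rewrite (act_braid_congr _ l_label (braid_congr_rev l_label vw)).
by rewrite /= !rev_cons !act_rcons sreflK.
Qed.

(** In the splitting of [u] along [s] and [t], the alternating word must be the
    full braid word: otherwise one of the two letters would add a positive root
    in front of [u], and so could not be a first letter. *)
Lemma two_heads u s t v w : redw u -> s != t -> u ~~ s :: v -> u ~~ t :: w ->
  exists m z, l s t = Some m /\ u ~~ alt m s t ++ z.
Proof.
move=> ru st uv uw.
have [j [a [b [z [ab uz ns nt]]]]] := split_exists ru st.
have neg c x : u ~~ c :: x -> ~ nneg (act (rev u) (alpha c)).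
  move=> ux n; have [rx nx] := (redw_congr R l_label ux).1 ru.
  apply: (root_sign_unique nx).
  rewrite -act_rev_cons_alpha.
  by rewrite -(act_braid_congr _ l_label (braid_congr_rev l_label ux)).
have neg_b : ~ nneg (act (rev u) (alpha b)).
  by case: ab => -[_ ->]; [exact: neg uw|exact: neg uv].
have abn : b != a by case: ab => -[-> ->] //; rewrite eq_sym.
have lab : l b a = l s t by case: ab => -[-> ->]; rewrite ?(lC t).
have short : (forall m, l s t = Some m -> (j < m)%N) -> False.
  move=> jm; apply: neg_b.
  rewrite (act_braid_congr _ l_label (braid_congr_rev l_label uz)).
  rewrite rev_cat act_cat.
  have [c [d [_ cd _ _ ->]]] := act_rev_alt_alpha R l_label j abn.
  rewrite act_lin lab; apply: nnegD.
  - apply: chebU_ge0 => m lm; split; [exact: l_label.2 lm|exact: jm].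
  - apply: chebU_ge0 => m lm; split; [exact: l_label.2 lm|exact/ltnW/jm].
  - by case: cd => -[-> _]; case: ab => -[aE bE]; rewrite ?aE ?bE.
  - by case: cd => -[_ ->]; case: ab => -[aE bE]; rewrite ?aE ?bE.
case lm: (l s t) short => [m|] short; last by case: short.
have [mj|jm] := leqP m j; last by case: short => _ [<-].
have [y yy] := alt_cat a b mj.
exists m, (y ++ z); split=> //; apply: braid_trans uz _.
rewrite yy -catA; case: ab => -[-> ->]; first exact: braid_refl.
by apply: braid_head; rewrite 1?eq_sym // lC.
Qed.

End Reduced.

(** * Cancellation and least common multiples *)

Section Elements.
Variables (R : realType) (Sigma : finType) (l : Sigma -> Sigma -> option nat).
Hypothesis l_label : artin_tits_label l.

Local Notation A := (artin_tits l).
Local Notation gen := (at_gen l).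
Local Notation len x := (at_length x%g).
Implicit Types (a b c s t : Sigma) (u v : seq Sigma) (x y z w p q : A).

Local Open Scope group_scope.

(** The laws [mulgA], [mulg1] and [mul1g] at this very type: rewriting with the
    generic laws leaves terms whose structure is inferred differently. *)
Lemma amulA x y z : x * (y * z) = x * y * z. Proof. exact: mulgA. Qed.
Lemma amul1 x : x * 1 = x. Proof. exact: mulg1. Qed.
Lemma a1mul x : 1 * x = x. Proof. exact: mul1g. Qed.

Definition Alt m a b : A := \pi_A (alt m a b).

Lemma pi_cat u v : \pi_A (u ++ v) = \pi_A u * \pi_A v.
Proof. by rewrite -at_mul_pi. Qed.

Lemma pi_cons a u : \pi_A (a :: u) = gen a * \pi_A u.
Proof. exact: (pi_cat [:: a]). Qed.

Lemma pi_rcons u a : \pi_A (rcons u a) = \pi_A u * gen a.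
Proof. by rewrite -cats1 pi_cat. Qed.

Lemma pi_nil : \pi_A [::] = 1. Proof. by []. Qed.

Lemma AltS m a b : Alt m.+1 a b = gen a * Alt m b a.
Proof. by rewrite /Alt altS pi_cons. Qed.

Lemma Alt_pred m a b : l a b = Some m -> Alt m a b = gen a * Alt m.-1 b a.
Proof. by move=> /l_label.2; case: m => // m _; exact: AltS. Qed.

Lemma Alt_braid m a b : a != b -> l a b = Some m -> Alt m a b = Alt m b a.
Proof.
move=> ab lab; apply/artin_tits_eqP.
by have := braid_head [::] ab lab; rewrite !cats0.
Qed.

Lemma at_lengthM x y : len (x * y) = (len x + len y)%N.
Proof.
by rewrite -[x]reprK -[y]reprK -pi_cat !at_length_pi size_cat.
Qed.

Lemma at_length1 : len (1 : A) = 0%N.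
Proof. exact: (at_length_pi l [::]). Qed.

Lemma at_length_gen a : len (gen a) = 1%N.
Proof. exact: (at_length_pi l [:: a]). Qed.

Lemma at_length_eq0 x : len x = 0%N -> x = 1.
Proof. by rewrite -[x]reprK at_length_pi => /size0nil ->. Qed.

Lemma gen_cases x : x = 1 \/ exists a y, x = gen a * y.
Proof.
rewrite -[x]reprK; case: (repr x) => [|a u]; first by left.
by right; exists a, (\pi_A u); rewrite pi_cons.
Qed.

Lemma le_l_refl x : le_l x x. Proof. by exists 1; rewrite amul1. Qed.

Lemma le_l1 x : le_l 1 x. Proof. by exists x; rewrite a1mul. Qed.

Lemma le_lM x y : le_l x (x * y). Proof. by exists y. Qed.

Lemma le_l_trans y x z : le_l x y -> le_l y z -> le_l x z.
Proof. by move=> [a ->] [b ->]; exists (a * b); rewrite amulA. Qed.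

Lemma le_l_mul2l w x y : le_l x y -> le_l (w * x) (w * y).
Proof. by move=> [a ->]; exists a; rewrite amulA. Qed.

Lemma le_l_length x y : le_l x y -> (len x <= len y)%N.
Proof. by move=> [a ->]; rewrite at_lengthM leq_addr. Qed.

Lemma le_l_eq x y : le_l x y -> (len y <= len x)%N -> x = y.
Proof.
move=> [a ->]; rewrite at_lengthM => h.
by rewrite (@at_length_eq0 a) ?amul1 //; lia.
Qed.

Lemma le_l_anti x y : le_l x y -> le_l y x -> x = y.
Proof. by move=> xy /le_l_length; exact: le_l_eq. Qed.


Definition red x : Prop := redw R l (repr x).

Lemma red_pi u : red (\pi_A u) <-> redw R l u.
Proof. by apply: redw_congr => //; exact: repr_pi_congr. Qed.

Lemma red_suffix x y : red (x * y) -> red y.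
Proof. by rewrite -[x]reprK -[y]reprK -pi_cat !red_pi; exact: redw_catr. Qed.

Lemma red_prefix x y : red (x * y) -> red x.
Proof.
rewrite -[x]reprK -[y]reprK -pi_cat !red_pi => /(redw_rev l_label).
by rewrite rev_cat => /redw_catr /(redw_rev l_label); rewrite revK.
Qed.

Lemma red_gen a : red (gen a).
Proof. by apply/red_pi; split=> //; exact: nneg_alpha. Qed.

(** If [s] and [t] both add a positive root to [w], then so do all the letters of
    the braid word, since they add nonnegative combinations of these two. This is
    the local form of the closure of reduced elements under least common
    multiples. *)
Lemma red_local w s t m : s != t -> l s t = Some m ->
  red (w * gen s) -> red (w * gen t) -> red (w * Alt m s t).
Proof.
move=> st lst; rewrite -[w]reprK -!pi_rcons -pi_cat !red_pi.
move=> /(redw_rev l_label) + /(redw_rev l_label).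
rewrite !rev_rcons => -[rw ns] [_ nt].
suff h : redw R l (rev (repr w ++ alt m s t)).
  by have := redw_rev l_label h; rewrite revK.
rewrite rev_cat rev_alt; have ts : t != s by rewrite eq_sym.
have lts : l t s = Some m by rewrite l_label.1.
case: (odd m); apply: redw_alt => // n.
  by rewrite lst => -[->].
by rewrite lts => -[->].
Qed.

Lemma red_gen_mul s x : red x -> ~ le_l (gen s) x -> red (gen s * x).
Proof.
rewrite -[x]reprK -pi_cons !red_pi => rx nsx; split=> //.
have [//|[v xv]] := exchange l_label s rx; exfalso; apply: nsx.
by exists (\pi_A v); rewrite -pi_cons; exact/artin_tits_eqP.
Qed.

Lemma not_red_sq a x y : ~ red (x * (gen a * (gen a * y))).
Proof.
move=> /red_suffix; rewrite -[y]reprK -(pi_cons a (repr y)).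
by rewrite -(pi_cons a (a :: repr y)) red_pi; exact: redw_sq.
Qed.

Lemma red_cancel s x y : red (gen s * x) -> gen s * x = gen s * y -> x = y.
Proof.
move=> rx e; have ry : red (gen s * y) by rewrite -e.
have {rx} := red_suffix rx; have {ry} := red_suffix ry; move: e.
rewrite -[x]reprK -[y]reprK -!pi_cons !red_pi => /artin_tits_eqP e ry rx.
apply/artin_tits_eqP; apply: (matsumoto l_label rx ry).
apply/funext => v.
have := act_braid_congr R l_label (braid_congr_rev l_label e).
move=> /(congr1 (@^~ (srefl l s v))).
by rewrite !rev_cons !act_rcons sreflK.
Qed.


(** The conclusion of Garside's reduction lemma for [s * x = t * y]: the two sides
    agree for the obvious reason. *)
Definition confluent s x t y : Prop := (s = t /\ x = y) \/
  (s != t /\ exists m z,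
    [/\ l s t = Some m, x = Alt m.-1 t s * z & y = Alt m.-1 s t * z]).

(** For reduced elements the reduction lemma comes from the Coxeter group. *)
Lemma red_confluent s x t y :
  red (gen s * x) -> gen s * x = gen t * y -> confluent s x t y.
Proof.
move=> rx e; have [st|st] := eqVneq s t.
  by left; split=> //; move: e; rewrite -st; exact: (red_cancel rx).
right; split=> //.
have ts : t != s by rewrite eq_sym.
have : exists m z, l s t = Some m /\ gen s * x = Alt m s t * z.
  move: rx e; rewrite -[x]reprK -[y]reprK -!pi_cons red_pi => rx.
  move=> /artin_tits_eqP e.
  have [m [z [lst ez]]] := two_heads l_label rx st (braid_refl _ _) e.
  by exists m, (\pi_A z); split=> //; rewrite -pi_cat; exact/artin_tits_eqP.
move=> [m [z [lst ez]]]; exists m, z; split=> //.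
  by apply: (red_cancel rx); rewrite ez amulA -Alt_pred.
apply: (@red_cancel t); first by rewrite -e.
by rewrite -e ez amulA -Alt_pred ?(Alt_braid st) // l_label.1.
Qed.

Definition confluent_at n := forall s x t y,
  len x = n -> gen s * x = gen t * y -> confluent s x t y.

Definition prefix_closed (X : A -> Prop) := forall x y, X (x * y) -> X x.

(** Together with [prefix_closed], this makes a set closed under all least common
    multiples ([lub_closed]): one only has to check two generators at a time. *)
Definition locally_closed (X : A -> Prop) := forall w s t m,
  s != t -> l s t = Some m -> X (w * gen s) -> X (w * gen t) ->
  X (w * Alt m s t).

(** The theory is bootstrapped by induction on the length: the reduction lemma
    below length [n] yields least common multiples of divisors of elements of
    length [n], and these yield the reduction lemma in length [n]. *)
Section BelowLength.
Variable n : nat.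
Hypothesis conf : forall k, (k < n)%N -> confluent_at k.

Lemma cancel_below p x y :
  (len (p * x) <= n)%N -> p * x = p * y -> x = y.
Proof.
rewrite -[p]reprK; elim: (repr p) => [|a u IH]; first by rewrite pi_nil !a1mul.
rewrite pi_cons -!amulA => h e.
have h' : (len (\pi_A u * x) < n)%N.
  by move: h; rewrite (at_lengthM (gen _)) at_length_gen; lia.
case: (conf h' erefl e) => [[_ ?]|[]]; last by rewrite eqxx.
by apply: IH => //; exact: ltnW.
Qed.

(** The usual completion of a diamond: the least common multiple is built by
    tiling with braid relations, and every tile stays in [X]. *)
Lemma join_below X : prefix_closed X -> locally_closed X ->
  forall z, (len z <= n)%N -> forall w x y,
  X (w * x) -> X (w * y) -> le_l x z -> le_l y z ->
  exists q, [/\ le_l x q, le_l y q, X (w * q), le_l q z &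
    forall z', (len z' <= n)%N -> le_l x z' -> le_l y z' -> le_l q z'].
Proof.
move=> Xp Xl z zn.
move: {2}(len z) (leqnn (len z)) => k.
elim: k z zn => [|k IH] z zn zk w x y Xx Xy xz yz.
  have z1 : z = 1 by apply: at_length_eq0; lia.
  have x1 : x = 1.
    by apply: at_length_eq0; move: (le_l_length xz); rewrite z1 at_length1; lia.
  exists y; split=> //; first by rewrite x1; exact: le_l1.
  exact: le_l_refl.
have [x1|[s [x' xE]]] := gen_cases x.
  exists y; split=> //; first by rewrite x1; exact: le_l1.
  exact: le_l_refl.
have [y1|[t [y' yE]]] := gen_cases y.
  exists x; split=> //; last by rewrite y1; exact: le_l1.
  exact: le_l_refl.
subst x y; move: xz yz => [f zE] [g zE'].
rewrite -amulA in zE; rewrite -amulA in zE'.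
have lz1 : (len (x' * f) < len z)%N.
  by rewrite zE (at_lengthM (gen _)) at_length_gen; lia.
have lz2 : (len (y' * g) < len z)%N.
  by rewrite zE' (at_lengthM (gen _)) at_length_gen; lia.
have zz : gen s * (x' * f) = gen t * (y' * g) by rewrite -zE.
have ltn : (len (x' * f) < n)%N by apply: leq_trans zn.
case: (conf ltn erefl zz) => [[st z12]|[st [m [h [lst e1 e2]]]]].
  subst t.
  have [||||||q [xq yq Xq qz lub]] := IH (x' * f) _ _ (w * gen s) x' y'.
  - exact: ltnW.
  - by rewrite -ltnS; apply: leq_trans zk.
  - by rewrite -amulA.
  - by rewrite -amulA.
  - exact: le_lM.
  - by rewrite z12; exact: le_lM.
  exists (gen s * q); split.
  - exact: le_l_mul2l.
  - exact: le_l_mul2l.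
  - by rewrite amulA.
  - by rewrite zE; exact: le_l_mul2l.
  move=> z' z'n [f' e'] [g' e'']; rewrite -amulA in e'; rewrite -amulA in e''.
  have l' : (len (x' * f') < n)%N.
    by apply: leq_trans z'n; rewrite e' (at_lengthM (gen _)) at_length_gen; lia.
  have e : x' * f' = y' * g'.
    by apply: (@cancel_below (gen s)); [rewrite -e'|rewrite -e' -e''].
  rewrite e'; apply/le_l_mul2l/lub; [exact: ltnW|exact: le_lM|].
  by rewrite e; exact: le_lM.
have ts : t != s by rewrite eq_sym.
have lts : l t s = Some m by rewrite l_label.1.
have [||||||q1 [xq1 aq1 Xq1 [f1 q1z] lub1]] :=
    IH (x' * f) _ _ (w * gen s) x' (Alt m.-1 t s).
- exact: ltnW.
- by rewrite -ltnS; apply: leq_trans zk.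
- by rewrite -amulA.
- rewrite -amulA -Alt_pred //; apply: Xl => //.
  + by apply: (Xp _ x'); rewrite -amulA.
  + by apply: (Xp _ y'); rewrite -amulA.
- exact: le_lM.
- by rewrite e1; exact: le_lM.
have [h1 q1E] := aq1.
pose q2 := Alt m.-1 s t * h1.
have q12 : gen s * q1 = gen t * q2.
  by rewrite q1E /q2 !amulA -!Alt_pred // (Alt_braid st).
clearbody q2.
have q2z : le_l q2 (y' * g).
  exists f1; apply: (@cancel_below (gen t)); first by rewrite -zE'.
  by rewrite -zE' amulA -q12 -amulA -q1z.
have [||||||q3 [q23 yq3 Xq3 q3z lub3]] := IH (y' * g) _ _ (w * gen t) q2 y'.
- exact: ltnW (leq_trans lz2 zn).
- by rewrite -ltnS; apply: leq_trans zk.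
- by rewrite -amulA -q12 amulA.
- by rewrite -amulA.
- by [].
- exact: le_lM.
exists (gen t * q3); split.
- apply: (@le_l_trans (gen s * q1)); first exact: le_l_mul2l.
  by rewrite q12; exact: le_l_mul2l.
- exact: le_l_mul2l.
- by rewrite amulA.
- by rewrite zE'; exact: le_l_mul2l.
move=> z' z'n [f' e'] [g' e'']; rewrite -amulA in e'; rewrite -amulA in e''.
have l' : (len (x' * f') < n)%N.
  by apply: leq_trans z'n; rewrite e' (at_lengthM (gen _)) at_length_gen; lia.
have l'' : (len (y' * g') < n)%N.
  by apply: leq_trans z'n; rewrite e'' (at_lengthM (gen _)) at_length_gen; lia.
case: (conf l' erefl (etrans (esym e') e'')) => [[/eqP]|[_ [m' [h' [+ e3 e4]]]]].
  by rewrite (negPf st).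
rewrite lst => -[mE]; rewrite -mE in e3 e4.
have [k' q1k] : le_l q1 (x' * f').
  by apply: lub1; [exact: ltnW|exact: le_lM|rewrite e3; exact: le_lM].
rewrite e''; apply/le_l_mul2l/lub3; [exact: ltnW| |exact: le_lM].
exists k'; apply: (@cancel_below (gen t)); first by rewrite -e''.
by rewrite -e'' e' q1k !amulA q12.
Qed.

(** The only difficult step of the reduction lemma. For three distinct generators,
    the two braid words starting with [c] are reduced, hence [c * q] is reduced,
    where [q] is the least common multiple of their tails; the relation between
    [s] and [t] can then be read on the reduced element [c * q]. *)
Lemma confluent_trans s x c z t y : len z = n ->
  confluent s x c z -> confluent c z t y -> confluent s x t y.
Proof.
move=> zn [[-> ->] //|[sc [m1 [U [l1 xE zE]]]]].
case=> [[<- <-]|[ct [m2 [V [l2 zE' yE]]]]]; first by right; split=> //; exists m1, U.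
have cs : c != s by rewrite eq_sym.
have lcs : l c s = Some m1 by rewrite l_label.1.
have [st|st] := eqVneq s t.
  left; split=> //; subst t.
  move: l2; rewrite lcs => -[m12]; subst m2; rewrite xE yE; congr (_ * _).
  by apply: (@cancel_below (Alt m1.-1 s c)); rewrite -zE ?zn.
right; split=> //.
have [|||||||q [[U' qU] [V' qV] rq [F zF] _]] := @join_below red _ _ z _ (gen c)
    (Alt m1.-1 s c) (Alt m2.-1 t c).
- exact: red_prefix.
- exact: red_local.
- by rewrite zn.
- rewrite -Alt_pred // -[Alt _ _ _]a1mul; apply: red_local => //;
    by rewrite a1mul; exact: red_gen.
- rewrite -Alt_pred // -[Alt _ _ _]a1mul; apply: red_local => //;
    by rewrite a1mul; exact: red_gen.
- by rewrite zE; exact: le_lM.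
- by rewrite zE'; exact: le_lM.
have UF : U = U' * F.
  apply: (@cancel_below (Alt m1.-1 s c)); first by rewrite -zE zn.
  by rewrite -zE zF qU amulA.
have VF : V = V' * F.
  apply: (@cancel_below (Alt m2.-1 t c)); first by rewrite -zE' zn.
  by rewrite -zE' zF qV amulA.
have e1 : gen c * q = gen s * (Alt m1.-1 c s * U').
  by rewrite qU !amulA -!Alt_pred // (Alt_braid cs).
have e2 : gen c * q = gen t * (Alt m2.-1 c t * V').
  by rewrite qV !amulA -!Alt_pred ?(Alt_braid ct) // l_label.1.
have rs : red (gen s * (Alt m1.-1 c s * U')) by rewrite -e1.
case: (red_confluent rs (etrans (esym e1) e2)) => [[/eqP]|[_]].
  by rewrite (negPf st).
move=> [m [Z [lst h1 h2]]]; exists m, (Z * F); split=> //.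
  by rewrite xE UF !amulA h1.
by rewrite yE VF !amulA h2.
Qed.

End BelowLength.

Lemma confluentC s x t y : confluent s x t y -> confluent t y s x.
Proof.
case=> [[-> ->]|[st [m [z [lst -> ->]]]]]; first by left.
by right; rewrite eq_sym; split=> //; exists m, z; rewrite l_label.1.
Qed.

(** Garside's reduction lemma: a derivation is a chain of words, each step of
    which is an instance of [confluent], and [confluent_trans] composes them. *)
Lemma all_confluent n : confluent_at n.
Proof.
elim/ltn_ind: n => n conf s x t y.
rewrite -[x]reprK -[y]reprK -!pi_cons at_length_pi => xn /artin_tits_eqP.
set u := s :: repr x; set v := t :: repr y => uv.
have un : size u = n.+1 by rewrite /= xn.
suff H : forall a b u' v', u = a :: u' -> v = b :: v' ->
  confluent a (\pi_A u') b (\pi_A v') by exact: H.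
clearbody u v; elim: uv un => {u v} [u|u v uv IH|u w v uw IH1 _ IH2|u v a b m ab lab] un c d u' v'.
- by move=> -> [-> ->]; left.
- move=> uE vE; apply/confluentC/IH => //.
  by rewrite (braid_congr_size uv).
- case: w uw IH1 IH2 => [|e w] uw IH1 IH2 uE vE.
    by move: (braid_congr_size uw); rewrite un.
  have wn : size (e :: w) = n.+1 by rewrite -(braid_congr_size uw).
  apply: confluent_trans (IH1 un _ _ _ _ uE erefl) (IH2 wn _ _ _ _ erefl vE) => //.
  by rewrite at_length_pi; case: wn => ->.
case: u {un} => [|e u]; last first.
  move=> [<- <-] [<- <-]; left; split=> //.
  exact/artin_tits_eqP/braid_step.
have m2 := l_label.2 _ _ _ lab.
rewrite !cat0s; case: m m2 lab => [//|m] _ lab; rewrite !altS => -[<- <-] [<- <-].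
by right; split=> //; exists m.+1, (\pi_A v); rewrite /= !pi_cat.
Qed.

Lemma at_mulgI p : injective (fun x => p * x).
Proof.
move=> x y; apply: (@cancel_below (len (p * x))) => // k _.
exact: all_confluent.
Qed.

Lemma le_l_mulI p x y : le_l (p * x) (p * y) -> le_l x y.
Proof. by move=> [z]; rewrite -amulA => /at_mulgI ->; exact: le_lM. Qed.

Definition is_lub x y q := [/\ le_l x q, le_l y q &
  forall z, le_l x z -> le_l y z -> le_l q z].

Lemma lub_unique x y q q' : is_lub x y q -> is_lub x y q' -> q = q'.
Proof.
by move=> [a b c] [d e f]; apply: le_l_anti; [exact: c|exact: f].
Qed.

Lemma lub_mul p x y q : is_lub x y q -> is_lub (p * x) (p * y) (p * q).
Proof.
move=> [a b c]; split; [exact: le_l_mul2l|exact: le_l_mul2l|].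
move=> _ [z ->]; rewrite -amulA => /le_l_mulI h; apply/le_l_mul2l/c => //.
exact: le_lM.
Qed.

Lemma join_closed (X : A -> Prop) w x y z : prefix_closed X -> locally_closed X ->
  X (w * x) -> X (w * y) -> le_l x z -> le_l y z ->
  exists2 q, is_lub x y q & X (w * q).
Proof.
move=> Xp Xl Xx Xy xz yz.
have conf n k : (k < n)%N -> confluent_at k by move=> _; exact: all_confluent.
have [q [xq yq Xq qz lub]] :=
  join_below (@conf (len z)) Xp Xl (leqnn _) Xx Xy xz yz.
exists q => //; split=> // z' xz' yz'.
have [q' [xq' yq' _ qz' lub']] :=
  join_below (@conf (len z' + len z)%N) Xp Xl (leq_addr _ _) Xx Xy xz' yz'.
apply: le_l_trans qz'; apply: lub => //.
have h : le_l q' z by apply: lub' => //; exact: leq_addl.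
exact: le_l_length.
Qed.

Lemma lub_exists x y z : le_l x z -> le_l y z -> exists q, is_lub x y q.
Proof.
move=> xz yz.
have Tp : prefix_closed (fun=> True) by [].
have Tl : locally_closed (fun=> True) by [].
by have [q h _] := join_closed (w := 1) Tp Tl I I xz yz; exists q.
Qed.

Lemma lub_closed (X : A -> Prop) x y q : prefix_closed X -> locally_closed X ->
  is_lub x y q -> X x -> X y -> X q.
Proof.
move=> Xp Xl h Xx Xy; have [xq yq _] := h.
rewrite -[x]a1mul in Xx; rewrite -[y]a1mul in Xy.
have [q' h'] := join_closed Xp Xl Xx Xy xq yq.
by rewrite a1mul (lub_unique h h').
Qed.

Lemma lub_red x y q : is_lub x y q -> red x -> red y -> red q.
Proof. by apply: lub_closed; [exact: red_prefix|exact: red_local]. Qed.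

Lemma is_joinP x y q : is_join [set x; y]%classic q <-> is_lub x y q.
Proof.
split=> [[h1 h2]|[h1 h2 h3]].
  split; [by apply: h1; left|by apply: h1; right|].
  by move=> z xz yz; apply: h2 => _ [->|->].
split=> [_ [->|->] //|z h]; apply: h3; apply: h; [by left|by right].
Qed.

End Elements.

(** * Parabolic elements and the Garside element *)

Section Descents.
Variables (R : realType) (Sigma : finType) (l : Sigma -> Sigma -> option nat).
Hypothesis l_label : artin_tits_label l.

Local Notation A := (artin_tits l).
Local Notation gen := (at_gen l).
Local Notation len x := (at_length x%g).
Local Notation Alt := (Alt l).
Local Notation red := (@red R Sigma l).
Implicit Types (a b c s t : Sigma) (u v : seq Sigma) (x y z w p q d : A).
Implicit Types (K : {set Sigma}).

Local Open Scope group_scope.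

Definition letters_in K x : Prop := all (mem K) (repr x).

Lemma braid_congr_all (P : pred Sigma) u v : braid_congr l u v -> all P u = all P v.
Proof.
elim=> // [w1 w2 w3 _ -> _ -> //|w1 w2 a b m ab lab].
have m2 := l_label.2 _ _ _ lab.
by rewrite !all_cat !all_alt // [P a && _]andbC.
Qed.

Lemma letters_in_pi K u : letters_in K (\pi_A u) = all (mem K) u.
Proof. by rewrite /letters_in (braid_congr_all _ (repr_pi_congr l u)). Qed.

Lemma letters_inM K x y : letters_in K (x * y) <-> letters_in K x /\ letters_in K y.
Proof.
rewrite -[x]reprK -[y]reprK -pi_cat !letters_in_pi all_cat.
by split=> [/andP[]|[-> ->]].
Qed.

Lemma letters_in1 K : letters_in K 1. Proof. by rewrite -pi_nil letters_in_pi. Qed.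

Lemma letters_in_gen K a : letters_in K (gen a) <-> a \in K.
Proof. by rewrite /at_gen letters_in_pi /= andbT. Qed.

Lemma letters_in_prefix K : prefix_closed (letters_in K).
Proof. by move=> x y /letters_inM[]. Qed.

Lemma letters_in_local K : locally_closed (letters_in K).
Proof.
move=> w s t m st lst /letters_inM[Kw /letters_in_gen Ks] /letters_inM[_ /letters_in_gen Kt].
apply/letters_inM; split=> //; rewrite letters_in_pi.
elim: m s t Ks Kt {st lst} => // m IH s t Ks Kt.
by rewrite altS /= Ks IH.
Qed.

Lemma act_support K u (x : Sigma -> R) r :
  all (mem K) u -> r \notin K -> act l u x r = x r.
Proof.
move=> + rK; elim: u => //= a u IH /andP[aK uK]; rewrite /srefl.
by case: eqP => [ra|_]; [move: rK; rewrite ra aK|exact: IH].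
Qed.

(** The inverse of [d] makes the simple roots of [K], hence all their nonnegative
    combinations, negative. If [c] could be added to [d], the image of its simple
    root under [d] would be such a combination, and applying the inverse of [d]
    would make the simple root of [c] negative. *)
Lemma not_red_right K d c : red d -> letters_in K d -> (forall b, b \in K -> le_l (gen b) d) ->
  c \in K -> ~ red (d * gen c).
Proof.
rewrite -[d]reprK -pi_rcons letters_in_pi; set u := repr d.
move=> /(red_pi R l_label) ru Ku Kd cK /(red_pi R l_label) /(redw_rev l_label).
rewrite rev_rcons => -[_]; rewrite revK => nc.
have neg b : b \in K -> nneg (fun r => - act l (rev u) (alpha R b) r).
  move=> /Kd [y]; rewrite -[y]reprK -pi_cons => /artin_tits_eqP uy.
  have [_ ny] := (redw_congr R l_label uy).1 ru.
  rewrite (act_braid_congr _ l_label (braid_congr_rev l_label uy)).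
  by rewrite act_rev_cons_alpha => r; rewrite opprK.
have : alpha R c c <= 0.
  rewrite -(act_revK l u (alpha R c)) act_sum; apply: sumr_le0 => b _.
  have [bK|bK] := boolP (b \in K).
    by rewrite mulr_ge0_le0 //; have := neg b bK c; rewrite oppr_ge0.
  rewrite (act_support _ Ku bK) /alpha.
  by case: eqP bK => [->|_ _]; rewrite ?cK // mul0r.
by rewrite /alpha eqxx ler10.
Qed.

Lemma finite_join (X : seq A) z : (forall x, x \in X -> le_l x z) ->
  exists d, [/\ forall x, x \in X -> le_l x d,
    forall z', (forall x, x \in X -> le_l x z') -> le_l d z' &
    forall P : A -> Prop, prefix_closed P -> locally_closed P -> P 1 ->
      (forall x, x \in X -> P x) -> P d].
Proof.
elim: X => [|x X IH] h.
  by exists 1; split=> // z' _; exact: le_l1.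
have [|d [d1 d2 d3]] := IH.
  by move=> y yX; apply: h; rewrite inE yX orbT.
have xz : le_l x z by apply: h; rewrite inE eqxx.
have dz : le_l d z by apply: d2 => y yX; apply: h; rewrite inE yX orbT.
have [q qlub] := lub_exists R l_label xz dz; have [xq dq q3] := qlub.
exists q; split.
- move=> y; rewrite inE => /orP[/eqP->//|/d1 yd]; exact: le_l_trans dq.
- move=> z' hz'; apply: q3; first by apply: hz'; rewrite inE eqxx.
  by apply: d2 => y yX; apply: hz'; rewrite inE yX orbT.
- move=> P Pp Pl P1 PX; apply: (lub_closed R l_label Pp Pl qlub).
    by apply: PX; rewrite inE eqxx.
  by apply: d3 => // y yX; apply: PX; rewrite inE yX orbT.
Qed.

(** The least common multiple of the generators in [K]: it is reduced and has its
    letters in [K] since both conditions are prefix closed and locally closed. *)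
Lemma delta_exists K z : (forall a, a \in K -> le_l (gen a) z) ->
  exists d, [/\ red d, letters_in K d & forall a, a \in K -> le_l (gen a) d].
Proof.
move=> h.
have [|d [d1 _ d3]] := @finite_join [seq gen a | a <- enum K] z.
  by move=> _ /mapP[a aK ->]; apply: h; rewrite mem_enum in aK.
exists d; split.
- apply: d3; [exact: red_prefix|exact: red_local| |].
    by rewrite -pi_nil; exact/(red_pi R l_label).
  by move=> _ /mapP[a _ ->]; exact: red_gen.
- apply: d3; [exact: letters_in_prefix|exact: letters_in_local|exact: letters_in1|].
  by move=> _ /mapP[a aK ->]; apply/letters_in_gen; rewrite mem_enum in aK.
- by move=> a aK; apply: d1; apply: map_f; rewrite mem_enum.
Qed.

(** A first letter [b] of [s * d] other than [s] forces [d] to start with the braid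
    word of [b] and [s] deprived of one letter; it has at least three letters, and
    so contains [s], unless [s] and [b] commute. *)
Lemma descent_gen_mul K s d b : s \notin K -> letters_in K d ->
  le_l (gen b) (gen s * d) -> b = s \/ (b \in K /\ l s b = Some 2%N).
Proof.
move=> sK Kd [y e].
case: (all_confluent R l_label erefl e) => [[-> _]|[sb [m [z [lsb dE _]]]]].
  by left.
right; have m2 := l_label.2 _ _ _ lsb.
move: Kd; rewrite dE => /letters_inM[+ _].
case: m m2 {dE} lsb => [|[|m]] //= _ lsb; rewrite AltS => /letters_inM[/letters_in_gen bK].
split=> //; case: m lsb b0 => [//|m] lsb.
by rewrite AltS => /letters_inM[/letters_in_gen]; rewrite (negPf sK).
Qed.

Lemma Alt_pred_le m a b : le_l (Alt m.-1 a b) (Alt m a b).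
Proof.
case: m => [|m]; first exact: le_l_refl.
by rewrite /Alt /= altSr pi_rcons; exact: le_lM.
Qed.

(** It suffices that [d] divides [b * d] for each generator [b]: an alternating word
    starting with [a] and one letter short of the braid word divides [d], and [b]
    in front of it gives a multiple of [a]. *)
Lemma delta_quasi_central d x : is_delta d -> exists y, x * d = d * y.
Proof.
move=> [d1 d2]; rewrite -[x]reprK; elim: (repr x) => [|b u [y IH]].
  by exists 1; rewrite pi_nil a1mul amul1.
have gd a : le_l (gen a) d by apply: d1; exists a.
suff [z bd] : le_l d (gen b * d).
  by exists (z * y); rewrite pi_cons -amulA IH !amulA bd.
apply: d2 => _ [a _ <-].
have [->|ab] := eqVneq a b; first exact: le_lM.
have [y1 e1] := gd a; have [y2 e2] := gd b.
have e : gen a * y1 = gen b * y2 by rewrite -e1.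
case: (all_confluent R l_label erefl e) => [[/eqP]|]; first by rewrite (negPf ab).
move=> [_ [m [z [lab y1E y2E]]]].
have lba : l b a = Some m by rewrite l_label.1.
have ba : b != a by rewrite eq_sym.
apply: (@le_l_trans _ _ (Alt m a b)).
  by rewrite (Alt_pred l_label lab); exact: le_lM.
rewrite (Alt_braid ab lab) (Alt_pred l_label lba).
apply: le_l_mul2l; apply: (@le_l_trans _ _ (Alt m a b)); first exact: Alt_pred_le.
by rewrite e1 y1E amulA -(Alt_pred l_label lab); exact: le_lM.
Qed.

(** The left divisors of the Garside element form a Garside set; quasi-centrality
    turns right divisors into left ones. *)
Lemma smallest_garside_le_delta d x : is_delta d -> smallest_garside x -> le_l x d.
Proof.
move=> dd Sx.
suff H : garside (fun y : A => le_l y d) by exact: (Sx _ H).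
split.
- by move=> a; apply: dd.1; exists a.
- move=> y z m yd zd /is_joinP [_ _]; exact.
- move=> y z [k kE] [t e]; have [t' tE] := delta_quasi_central t dd.
  exists (k * t'); apply: (@at_mulgI R _ _ l_label t).
  by rewrite /= tE kE e !amulA.
Qed.

End Descents.

(** * The boundary *)

Section Boundary.
Variables (R : realType) (Sigma : finType) (l : Sigma -> Sigma -> option nat).
Hypothesis l_label : artin_tits_label l.

Local Notation A := (artin_tits l).
Local Notation gen := (at_gen l).
Local Notation bnd := (boundary l).
Implicit Types (x y z t q : A) (xi : bnd) (a b : Sigma).

Local Open Scope group_scope.

Definition pre xi j : A := \prod_(i < j) boundary_seq xi i.

Lemma pre0 xi : pre xi 0 = 1. Proof. exact: big_ord0. Qed.

Lemma preS xi j : pre xi j.+1 = pre xi j * boundary_seq xi j.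
Proof. exact: big_ord_recr. Qed.

Lemma boundaryP xi : boundary_set (boundary_seq xi).
Proof. exact: (set_mem (valP xi)). Qed.

Lemma boundary_simple xi j : smallest_garside (boundary_seq xi j).
Proof. exact: ((boundaryP xi).1 j).1. Qed.

Lemma boundary_arrow xi j : arrow (boundary_seq xi j) (boundary_seq xi j.+1).
Proof. exact: (boundaryP xi).2. Qed.

Definition window xi i j : A := \prod_(k < j) boundary_seq xi (i + k)%N.

Lemma windowS xi i j :
  window xi i j.+1 = boundary_seq xi i * window xi i.+1 j.
Proof.
rewrite /window big_ord_recl addn0; congr (_ * _).
by apply: eq_bigr => k _; rewrite lift0 addSnnS.
Qed.

Lemma preD xi i j : pre xi (i + j) = pre xi i * window xi i j.
Proof.
elim: j => [|j IH]; first by rewrite addn0 /window big_ord0 amul1.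
by rewrite addnS preS IH -amulA /window big_ord_recr.
Qed.

Lemma pre_mono xi i j : (i <= j)%N -> le_l (pre xi i) (pre xi j).
Proof. by move=> /subnKC <-; rewrite preD; exact: le_lM. Qed.

(** The greedy property is local in the definition of [arrow] and propagates: the
    part of [s] that sticks out of the first entry is simple, and divides the rest
    of the window, hence the second entry by induction. *)
Lemma window_head xi i j (s : A) : smallest_garside s -> le_l s (window xi i j.+1) ->
  le_l s (boundary_seq xi i).
Proof.
elim: j i s => [|j IH] i s Ss.
  by rewrite windowS /window big_ord0 amul1.
rewrite windowS => sw.
have [q qlub] := lub_exists R l_label sw (le_lM _ _).
have [sq [t qt] q3] := qlub.
have [_ Sjoin Sr] := smallest_garside_garside l.
have Sq : smallest_garside q.
  apply: (Sjoin s (boundary_seq xi i)) => //; first exact: boundary_simple.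
  exact/is_joinP.
have St : smallest_garside t by apply: Sr Sq _; exists (boundary_seq xi i).
have tw : le_l t (window xi i.+1 j.+1).
  apply: (@le_l_mulI R _ _ l_label (boundary_seq xi i)); rewrite -qt.
  by apply: q3 => //; exact: le_lM.
have [h _] := boundary_arrow xi i.
apply: h; split=> //; apply: le_l_trans sq _; rewrite qt.
by apply: le_l_mul2l; exact: IH tw.
Qed.

Lemma upP x xi : up x xi <-> exists j, le_l x (pre xi j).
Proof.
split=> [[j _ h]|[j h]]; first by exists j.
by exists j.+1 => //; apply: le_l_trans h _; exact: pre_mono.
Qed.

Lemma up_le x y : le_l x y -> up y `<=` up x.
Proof. by move=> xy xi /upP[j h]; apply/upP; exists j; exact: le_l_trans h. Qed.

Lemma up1 : up 1 = [set: bnd].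
Proof. by apply/seteqP; split=> // xi _; apply/upP; exists 0%N; exact: le_l1. Qed.

Lemma up_bound x y xi : up x xi -> up y xi -> exists2 q, is_lub x y q & up q xi.
Proof.
move=> /upP[i xi'] /upP[j yj].
have xz : le_l x (pre xi (i + j)) by apply: le_l_trans xi' _; apply/pre_mono/leq_addr.
have yz : le_l y (pre xi (i + j)) by apply: le_l_trans yj _; apply/pre_mono/leq_addl.
have [q qlub] := lub_exists R l_label xz yz; exists q => //.
by apply/upP; exists (i + j)%N; case: qlub => _ _; exact.
Qed.

Lemma upI_lub x y q : is_lub x y q -> up x `&` up y = up q.
Proof.
move=> h; have [xq yq _] := h; apply/seteqP; split=> xi /=.
  by move=> [hx hy]; have [q' h'] := up_bound hx hy; rewrite (lub_unique h h').
by move=> hq; split; [exact: up_le hq|exact: up_le hq].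
Qed.

Lemma upI_none x y : ~ (exists q, is_lub x y q) -> up x `&` up y = set0.
Proof.
move=> h; apply/seteqP; split=> // xi [hx hy]; apply: h.
by have [q] := up_bound hx hy; exists q.
Qed.

(** The entry of index [i] is the largest simple element that can follow the
    first entries, and this can be read on the sets [up x]. *)
Lemma up_pre_simple xi i (s : A) : smallest_garside s -> up (pre xi i * s) xi ->
  le_l s (boundary_seq xi i).
Proof.
move=> Ss /upP[j h].
have {}h : le_l (pre xi i * s) (pre xi (i + j.+1)).
  by apply: le_l_trans h _; apply: pre_mono; lia.
rewrite preD in h; exact: window_head (le_l_mulI R l_label h).
Qed.

Lemma up_gen_cover xi : exists a, up (gen a) xi.
Proof.
have [a [y e]] : exists a y, boundary_seq xi 0 = gen a * y.
  by case: (gen_cases (boundary_seq xi 0)) => // e; case: ((boundaryP xi).1 0%N).2.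
by exists a; apply/upP; exists 1%N; rewrite preS pre0 a1mul e; exact: le_lM.
Qed.

Lemma up_finite (X : seq A) xi : (forall x, x \in X -> up x xi) ->
  exists z, forall x, x \in X -> le_l x z.
Proof.
elim: X => [|x X IH] h; first by exists 1.
suff [j hj] : exists j, forall y, y \in x :: X -> le_l y (pre xi j).
  by exists (pre xi j).
elim: (x :: X) h => {X IH x} [|x X IH] h; first by exists 0%N.
have [j hj] : exists j, forall y, y \in X -> le_l y (pre xi j).
  by apply: IH => y yX; apply: h; rewrite inE yX orbT.
have /upP[k hk] : up x xi by apply: h; rewrite inE eqxx.
exists (j + k)%N => y; rewrite inE => /orP[/eqP ->|/hj yj].
  by apply: le_l_trans hk _; apply/pre_mono/leq_addl.
by apply: le_l_trans yj _; apply/pre_mono/leq_addr.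
Qed.

Definition cyl (s : seq A) : set bnd :=
  [set xi | forall i, (i < size s)%N -> boundary_seq xi i = nth 1 s i].

Definition coord i x : set bnd := [set xi | boundary_seq xi i = x].

Lemma cyl_nil : cyl [::] = setT.
Proof. by apply/seteqP; split. Qed.

Lemma cyl_rcons (s : seq A) x : cyl (rcons s x) = cyl s `&` coord (size s) x.
Proof.
apply/seteqP; split=> xi.
  move=> h; split=> [i si|]; last first.
    by rewrite /coord /= h ?size_rcons // nth_rcons ltnn eqxx.
  by rewrite h ?size_rcons ?nth_rcons ?si //; exact: ltnW.
move=> [h1 h2] i; rewrite size_rcons ltnS leq_eqVlt nth_rcons => /orP[/eqP ->|si].
  by rewrite ltnn eqxx.
by rewrite si; exact: h1.
Qed.

Lemma cyl_mkseq xi n : cyl (mkseq (boundary_seq xi) n) xi.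
Proof. by move=> i; rewrite size_mkseq => si; rewrite nth_mkseq. Qed.

Definition prodA (s : seq A) : A := \prod_(x <- s) x.

Lemma prodA_rcons (s : seq A) x : prodA (rcons s x) = prodA s * x.
Proof. by rewrite /prodA -cats1 big_cat big_seq1. Qed.

Lemma cyl_pre (s : seq A) xi : cyl s xi -> pre xi (size s) = prodA s.
Proof.
elim/last_ind: s => [|s x IH]; first by rewrite pre0 /prodA big_nil.
rewrite cyl_rcons size_rcons => -[/IH e c].
by rewrite preS e c prodA_rcons.
Qed.

Lemma up_cyl x : up x = \bigcup_(s in [set s | le_l x (prodA s)]) cyl s.
Proof.
apply/seteqP; split=> xi.
  move=> /upP[j h]; exists (mkseq (boundary_seq xi) j); last exact: cyl_mkseq.
  by have := cyl_pre (@cyl_mkseq xi j); rewrite size_mkseq /= => <-.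
move=> [s /= h c]; apply/upP; exists (size s); by rewrite (cyl_pre c).
Qed.

Lemma countable_at : countable [set: A].
Proof.
apply/countable_injP; exists (fun x => pickle (repr x)).
by move=> x y _ _ /(pcan_inj (@pickleK _)) e; rewrite -[x]reprK e reprK.
Qed.

Lemma countable_seq_at : countable [set: seq A].
Proof.
apply/countable_injP; exists (fun s => pickle [seq repr x | x <- s]).
by move=> s t _ _ /(pcan_inj (@pickleK _)) /inj_map; apply; exact: (can_inj (@reprK _ _)).
Qed.

(** The filter of sets containing a cylinder around [xi] converges to [xi]
    coordinatewise. *)
Lemma open_cyl (x0 : bnd) (U : set (boundary_at x0)) xi : open U -> U xi ->
  exists n, cyl (mkseq (boundary_seq xi) n) `<=` U.
Proof.
move=> [V oV VU] Uxi.
pose F : set (set (nat -> A)) := [set B | exists n, forall y : nat -> A,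
  (forall i, (i < n)%N -> y i = boundary_seq xi i) -> B y].
have FF : Filter F.
  split; first by exists 0%N.
  - move=> P Q [n Pn] [m Qm]; exists (n + m)%N => y h; split.
      by apply: Pn => i ni; apply: h; lia.
    by apply: Qm => i ni; apply: h; lia.
  - by move=> P Q PQ [n Pn]; exists n => y /Pn /PQ.
have Fx : (F : set_system {ptws nat -> discrete_topology A}) -->
    (boundary_seq xi : {ptws nat -> discrete_topology A}).
  apply/cvg_sup => i B [C [[D oD <-] Dx] CB].
  exists i.+1 => y h; apply: CB => /=; rewrite /proj h //.
have [n h] : F V.
  apply: Fx; apply: open_nbhs_nbhs; split=> //.
  by move: Uxi; rewrite -VU.
exists n => z cz; rewrite -VU; apply: h => i ni.
by rewrite -[LHS]/(boundary_seq z i) cz ?size_mkseq // nth_mkseq.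
Qed.

Lemma open_coord (x0 : bnd) i x : open (coord i x : set (boundary_at x0)).
Proof.
exists ((fun y : {ptws nat -> discrete_topology A} => y i) @^-1` [set x]); last by [].
apply: open_comp; last exact: discrete_open.
by move=> y _; apply: (@proj_continuous _ (fun=> discrete_topology A) i).
Qed.

End Boundary.

(** * A finite measure is determined by its values on the sets [up x] *)

Section Generation.
Variables (R : realType) (Sigma : finType) (l : Sigma -> Sigma -> option nat).
Hypothesis l_label : artin_tits_label l.
Variable x0 : boundary l.

Local Notation A := (artin_tits l).
Local Notation bnd := (boundary_at x0).
Local Notation borel := (borel_boundary x0).

Lemma measurable_coord i (x : A) : measurable (coord i x : set borel).
Proof. by apply: sub_sigma_algebra; exact: (open_coord x0). Qed.

Lemma measurable_cyl (s : seq A) : measurable (cyl s : set borel).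
Proof.
elim/last_ind: s => [|s x IH]; first by rewrite cyl_nil; exact: measurableT.
by rewrite cyl_rcons; apply: measurableI => //; exact: measurable_coord.
Qed.

Lemma measurable_up (x : A) : measurable (up x : set borel).
Proof.
rewrite up_cyl bigcup_mkcond.
apply: countable_bigcupT_measurable; first exact: countable_seq_at.
by move=> s; case: ifP => _ //; exact: measurable_cyl.
Qed.

Definition up_class : set (set bnd) := [set U | U = set0 \/ exists x : A, U = up x].

Lemma up_class_setI : setI_closed up_class.
Proof.
move=> _ _ [->|[x ->]] [->|[y ->]]; rewrite ?set0I ?setI0; try by left.
have [[q qlub]|nq] := pselect (exists q, is_lub x y q).
  by right; exists q; exact: (upI_lub R l_label).
by left; exact: (upI_none R l_label).
Qed.

Let G_type : measurableType _ := g_sigma_algebraType up_class.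

Lemma gen_up x : <<s up_class >> (up x : set bnd).
Proof. by apply: sub_sigma_algebra; right; exists x. Qed.

(** The last entry of a cylinder is pinned down as the largest simple element that
    can follow the preceding ones; countably many simple elements have to be
    excluded. *)
Lemma gen_cyl (s : seq A) : <<s up_class >> (cyl s : set bnd).
Proof.
elim/last_ind: s => [|s x IH].
  by rewrite cyl_nil; exact: (@measurableT _ G_type).
have [Sx|Sx] := pselect (smallest_garside x); last first.
  suff -> : cyl (rcons s x) = set0 by exact: (@measurable0 _ G_type).
  apply/seteqP; split=> // xi; rewrite cyl_rcons => -[_ c]; apply: Sx.
  by rewrite -c; exact: boundary_simple.
pose D : set A := [set y | [/\ smallest_garside y, le_l x y & y <> x]].
have -> : cyl (rcons s x) = cyl s `&`
    (up (prodA s * x)%g `\` \bigcup_(y in D) up (prodA s * y)%g).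
  rewrite cyl_rcons; apply/seteqP; split=> xi [c h]; split=> //.
    have pE := cyl_pre c; rewrite /coord /= in h.
    split; first by apply/upP; exists (size s).+1; rewrite preS pE h; exact: le_l_refl.
    move=> [y [Sy xy yx]]; rewrite -pE => /(up_pre_simple R l_label Sy).
    by rewrite h => /(le_l_anti xy) /esym.
  have pE := cyl_pre c; have [hx hy] := h; rewrite /coord /=.
  rewrite -pE in hx; have xle := up_pre_simple R l_label Sx hx.
  apply: contrapT => ne; apply: hy; exists (boundary_seq xi (size s)).
    by split=> //; exact: boundary_simple.
  by apply/upP; exists (size s).+1; rewrite preS pE; exact: le_l_refl.
apply: (@measurableI _ G_type) => //; apply: (@measurableD _ G_type).
  exact: gen_up.
rewrite bigcup_mkcond.
apply: (@countable_bigcupT_measurable _ G_type); first exact: countable_at.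
by move=> y; case: ifP => _; [exact: gen_up|exact: (@measurable0 _ G_type)].
Qed.

Lemma gen_open (U : set bnd) : open U -> <<s up_class >> U.
Proof.
move=> oU.
have -> : U = \bigcup_(s in [set s : seq A | cyl s `<=` U]) cyl s.
  apply/seteqP; split=> [xi Uxi|xi [s /= sU c]]; last exact: sU.
  have [n nU] := open_cyl oU Uxi.
  by exists (mkseq (boundary_seq xi) n) => //; exact: cyl_mkseq.
rewrite bigcup_mkcond.
apply: (@countable_bigcupT_measurable _ G_type); first exact: countable_seq_at.
by move=> s; case: ifP => _; [exact: gen_cyl|exact: (@measurable0 _ G_type)].
Qed.

Lemma eq_measure_up (nu1 nu2 : {finite_measure set borel -> \bar R}) :
  (forall x : A, nu1 (up x) = nu2 (up x)) ->
  forall B, measurable B -> nu1 B = nu2 B.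
Proof.
move=> e B mB.
apply: (@g_sigma_algebra_measure_unique _ R borel up_class _ (fun=> setT)).
- by move=> _ [->|[x ->]]; [exact: measurable0|exact: measurable_up].
- by move=> _; right; exists 1%g; rewrite up1.
- by apply/seteqP; split=> // xi _; exists 0%N.
- exact: up_class_setI.
- by move=> _ [->|[x ->]]; [rewrite !measure0|exact: e].
- by move=> _; rewrite ltey_eq fin_num_measure.
move: B mB; apply: smallest_sub; first exact: smallest_sigma_algebra.
exact: gen_open.
Qed.

End Generation.

(** * Finite measures as real-valued set functions *)

Section FiniteContent.
Variables (d : measure_display) (T : measurableType d) (R : realType).
Variable nu : {finite_measure set T -> \bar R}.

Definition mass (E : set T) : R := fine (nu E).

Lemma mass_ge0 E : 0 <= mass E.
Proof. exact: fine_ge0. Qed.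

Lemma mass0 : mass set0 = 0. Proof. by rewrite /mass measure0. Qed.

Lemma nu_fin E : measurable E -> nu E \is a fin_num.
Proof. exact: fin_num_measure. Qed.

Lemma mass_split E F : measurable E -> measurable F ->
  mass E = mass (E `&` F) + mass (E `\` F).
Proof.
move=> mE mF; rewrite /mass -fineD; last 2 first.
- by apply: nu_fin; exact: measurableI.
- by apply: nu_fin; exact: measurableD.
by rewrite addeC -measureDI.
Qed.

Lemma mass_le E F : measurable E -> measurable F -> E `<=` F -> mass E <= mass F.
Proof.
move=> mE mF EF; rewrite (mass_split mF mE) (setIidr EF).
by rewrite lerDl mass_ge0.
Qed.

Lemma massC E : measurable E -> mass (~` E) = mass setT - mass E.
Proof.
move=> mE; rewrite (mass_split measurableT mE) setTI setTD.
by rewrite addrAC subrr add0r.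
Qed.

Lemma massE E : measurable E -> nu E = (mass E)%:E.
Proof. by move=> mE; rewrite fineK // nu_fin. Qed.

Variable I : eqType.
Implicit Types (s : seq I) (C : I -> set T).

Lemma sum_mass_le s C D : uniq s -> measurable D ->
  (forall i, measurable (C i)) -> (forall i, i \in s -> C i `<=` D) ->
  (forall i j x, i \in s -> j \in s -> C i x -> C j x -> i = j) ->
  \sum_(i <- s) mass (C i) <= mass D.
Proof.
elim: s D => [|i s IH] D; first by rewrite big_nil mass_ge0.
move=> /= /andP[si us] mD mC CD disj; rewrite big_cons (mass_split mD (mC i)).
rewrite setIC setIidl; last by apply: CD; rewrite inE eqxx.
rewrite lerD2l; apply: IH => //.
- exact: measurableD.
- move=> j js x Cx; split; first by apply: CD Cx; rewrite inE js orbT.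
  move=> Cix; move: si; rewrite (disj i j x) ?js ?inE ?eqxx ?js ?orbT //.
- by move=> j k x js ks; apply: disj; rewrite inE ?js ?ks orbT.
Qed.

Lemma mass_le_sum s C D : measurable D -> (forall i, measurable (C i)) ->
  (forall x, D x -> exists2 i, i \in s & C i x) ->
  mass D <= \sum_(i <- s) mass (C i).
Proof.
elim: s D => [|i s IH] D mD mC cov.
  rewrite big_nil (_ : D = set0) ?mass0 //.
  by apply/seteqP; split=> // x /cov[].
rewrite big_cons (mass_split mD (mC i)); apply: lerD.
  by apply: mass_le => //; exact: measurableI.
apply: IH => //; first exact: measurableD.
move=> x [/cov[j]]; rewrite inE => /orP[/eqP-> //|js] Cj _.
by exists j.
Qed.

End FiniteContent.

(** * Uniform measures and largest reduced divisors *)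

Section Spheres.
Variables (Sigma : finType) (l : Sigma -> Sigma -> option nat).
Local Notation A := (artin_tits l).
Local Notation len x := (at_length x%g).

Definition sphere n : seq A :=
  undup [seq \pi_A (val t) | t : n.-tuple Sigma].

Lemma mem_sphere n (x : A) : (x \in sphere n) = (len x == n).
Proof.
rewrite mem_undup; apply/mapP/eqP => [[t _ ->]|xn].
  by rewrite at_length_pi size_tuple.
have h : size (repr x) == n by rewrite -xn.
by exists (Tuple h); rewrite ?mem_enum //= reprK.
Qed.

Definition punctured_ball n : seq A :=
  undup (flatten [seq sphere k | k <- iota 1 n]).

Lemma mem_punctured_ball n (x : A) :
  (x \in punctured_ball n) = (0 < len x <= n)%N.
Proof.
rewrite mem_undup; apply/flattenP/idP => [[_ /mapP[k + ->]]|h].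
  by rewrite mem_iota mem_sphere => + /eqP ->; lia.
exists (sphere (len x)); last by rewrite mem_sphere.
by apply: map_f; rewrite mem_iota; lia.
Qed.

End Spheres.

Section Uniform.
Variables (R : realType) (Sigma : finType) (l : Sigma -> Sigma -> option nat).
Hypothesis l_label : artin_tits_label l.
Variable x0 : boundary l.

Local Notation A := (artin_tits l).
Local Notation gen := (at_gen l).
Local Notation len x := (at_length x%g).
Local Notation borel := (borel_boundary x0).
Local Notation full := [set: Sigma]%SET.
Local Notation red := (@red R Sigma l).
Implicit Types (x y z w q : A) (a b c : Sigma) (T K : {set Sigma}) (xi : boundary l).

Definition avoid_at x T : set borel :=
  [set xi | up x xi /\ forall a, a \in T -> ~ up (x * gen a)%g xi].

Definition avoid T : set borel :=
  [set xi | forall a, a \in T -> ~ up (gen a) xi].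

Definition follow w : {set Sigma} := [set a | `[< red (w * gen a)%g >]].

(** The points whose largest reduced left divisor is [w] ([head_set_max]). *)
Definition head_set w : set borel := avoid_at w (follow w).

Lemma avoidE T : avoid T = avoid_at 1%g T.
Proof.
apply/seteqP; split=> xi.
  by move=> h; split=> [|a aT]; [rewrite up1|rewrite a1mul; exact: h].
by move=> [_ h] a aT; have := h a aT; rewrite a1mul.
Qed.

Definition avoid_seq x z (s : seq Sigma) : set borel :=
  [set xi | up (x * z)%g xi /\ forall a, a \in s -> ~ up (x * gen a)%g xi].

Lemma avoid_seq_nil x z : avoid_seq x z [::] = up (x * z)%g.
Proof. by apply/seteqP; split=> [xi []|xi h] //; split. Qed.

Lemma avoid_seq_cons x z a s :
  avoid_seq x z (a :: s) = avoid_seq x z s `\` up (x * gen a)%g.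
Proof.
apply/seteqP; split=> xi.
  move=> [h1 h2]; split; last by apply: h2; rewrite inE eqxx.
  by split=> // b bs; apply: h2; rewrite inE bs orbT.
move=> [[h1 h2] h3]; split=> // b; rewrite inE => /orP[/eqP->//|]; exact: h2.
Qed.

Lemma avoid_atE x T : avoid_at x T = avoid_seq x 1%g (enum T).
Proof.
apply/seteqP; split=> xi [h1 h2]; split.
- by rewrite amul1.
- by move=> a; rewrite mem_enum; exact: h2.
- by rewrite amul1 in h1.
- by move=> a aT; apply: h2; rewrite mem_enum.
Qed.

Lemma measurable_avoid_seq x z s : measurable (avoid_seq x z s).
Proof.
elim: s => [|a s IH]; first by rewrite avoid_seq_nil; exact: measurable_up.
by rewrite avoid_seq_cons; apply: measurableD => //; exact: measurable_up.
Qed.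

Lemma measurable_avoid_at x T : measurable (avoid_at x T).
Proof. by rewrite avoid_atE; exact: measurable_avoid_seq. Qed.

Lemma measurable_avoid T : measurable (avoid T).
Proof. by rewrite avoidE; exact: measurable_avoid_at. Qed.

(** The least common multiple of [w] and [x] is reduced. If it were larger than
    [w], the letter that follows [w] in it would be excluded by [head_set w]. *)
Lemma head_set_max w x xi : red w -> head_set w xi -> red x -> up x xi ->
  le_l x w.
Proof.
move=> rw [wxi h] rx xxi.
have [q qlub qxi] := up_bound R l_label wxi xxi.
have rq := lub_red l_label qlub rw rx.
have [[z qE] xq _] := qlub.
case: (gen_cases z) => [z1|[a [y zE]]]; first by move: xq; rewrite qE z1 amul1.
exfalso; apply: (h a).
  rewrite inE; apply/asboolP; apply: (red_prefix l_label (y := y)).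
  by rewrite -amulA -zE -qE.
by apply: up_le qxi; rewrite qE zE amulA; exact: le_lM.
Qed.

Lemma head_set_inj w x xi : red w -> red x -> head_set w xi -> head_set x xi ->
  w = x.
Proof.
move=> rw rx hw hx; apply: le_l_anti.
  exact: head_set_max hx rw hw.1.
exact: head_set_max hw rx hx.1.
Qed.

Lemma red1 : red 1%g.
Proof. by rewrite -pi_nil; exact/(red_pi R l_label). Qed.

(** Start from the unit and add letters as long as possible. The first case is that
    of points that may have no largest reduced divisor. *)
Lemma head_set_exists xi n : (exists w, [/\ red w, len w = n & up w xi]) \/
  (exists w, [/\ red w, (len w < n)%N & head_set w xi]).
Proof.
elim: n => [|n [[w [rw wn wxi]]|[w [rw wn wxi]]]].
- left; exists 1%g; rewrite up1; split=> //; [exact: red1|exact: at_length1].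
- have [h|h] := pselect (head_set w xi).
    by right; exists w; split=> //; rewrite wn.
  left; apply: contrapT => h'; apply: h; split=> // a.
  rewrite inE => /asboolP ra wa; apply: h'; exists (w * gen a)%g; split=> //.
  by rewrite at_lengthM at_length_gen wn addn1.
- by right; exists w; split=> //; exact: ltnW.
Qed.

Lemma follow_neqT w : (0 < len w)%N -> follow w != full.
Proof.
move=> w0; apply/eqP => e.
have [u [a wE]] : exists u a, w = (u * gen a)%g.
  move: w0; rewrite -[w]reprK at_length_pi; case/lastP: (repr w) => // u a _.
  by exists (\pi_A u), a; rewrite pi_rcons.
have : a \in follow w by rewrite e inE.
rewrite inE => /asboolP; rewrite wE -amulA -[(gen a * gen a)%g]amul1 -amulA.
exact: not_red_sq.
Qed.

Lemma head_set1 : head_set 1%g = set0.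
Proof.
apply/seteqP; split=> // xi [_ h]; have [a ha] := up_gen_cover xi.
apply: (h a); last by rewrite a1mul.
by rewrite inE; apply/asboolP; rewrite a1mul; exact: red_gen.
Qed.

Section Measure.
Variable nu : {finite_measure set borel -> \bar R}.
Variable p : R.
Hypothesis nu_up : forall x, nu (up x) = (p ^+ len x)%:E.

Local Notation m := (mass nu).

Lemma mass_up x : m (up x) = p ^+ len x.
Proof. by rewrite /mass nu_up. Qed.

Lemma mass_setT : m setT = 1.
Proof. by rewrite -(up1 l) mass_up at_length1 expr0. Qed.

(** Removing one letter at a time, as in inclusion-exclusion: the set removed is
    again of the same form, with [z] replaced by its least common multiple with
    the letter. *)
Lemma mass_avoid_seq x z s :
  m (avoid_seq x z s) = p ^+ len x * m (avoid_seq 1%g z s).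
Proof.
elim: s z => [|a s IH] z.
  by rewrite !avoid_seq_nil a1mul !mass_up at_lengthM exprD.
have key y : m (avoid_seq y z (a :: s)) =
    m (avoid_seq y z s) - m (avoid_seq y z s `&` up (y * gen a)%g).
  rewrite avoid_seq_cons (mass_split nu (measurable_avoid_seq y z s)
    (measurable_up (y * gen a)%g)).
  by rewrite addrAC subrr add0r.
rewrite (key x) (key 1%g) mulrBr -IH; congr (_ - _).
have inter y q : avoid_seq y q s =
    up (y * q)%g `&` [set xi | forall b, b \in s -> ~ up (y * gen b)%g xi].
  by apply/seteqP; split.
have [[q qlub]|nq] := pselect (exists q, is_lub z (gen a) q).
  have e y : avoid_seq y z s `&` up (y * gen a)%g = avoid_seq y q s.
    rewrite !inter setIAC; congr (_ `&` _).
    exact: (upI_lub R l_label (lub_mul R l_label y qlub)).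
  by rewrite !e IH.
have e y : avoid_seq y z s `&` up (y * gen a)%g = set0.
  rewrite inter setIAC (upI_none R l_label) ?set0I // => -[q [[t1 e1] yq2 _]].
  apply: nq; apply: (lub_exists R l_label (z := (z * t1)%g)).
    exact: le_lM.
  apply: (le_l_mulI R l_label (p := y)); by rewrite amulA -e1.
by rewrite !e mass0 mulr0.
Qed.

Lemma mass_avoid_at x T : m (avoid_at x T) = p ^+ len x * m (avoid T).
Proof. by rewrite avoidE !avoid_atE mass_avoid_seq. Qed.

Lemma mass_head_set w : m (head_set w) = p ^+ len w * m (avoid (follow w)).
Proof. exact: mass_avoid_at. Qed.

Lemma mass_avoid_set0 : m (avoid finset.set0) = 1.
Proof.
rewrite -mass_setT; congr (m _); apply/seteqP; split=> // xi _ a.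
by rewrite inE.
Qed.

Lemma mass_avoid_setT : m (avoid full) = 0.
Proof.
rewrite -(mass0 nu); congr (m _); apply/seteqP; split=> // xi h.
by have [a /h] := up_gen_cover xi; apply; rewrite inE.
Qed.

Lemma mass_avoid_sub T K : T \subset K -> m (avoid K) <= m (avoid T).
Proof.
move=> TK; apply: mass_le; [exact: measurable_avoid|exact: measurable_avoid|].
by move=> xi h a aT; apply: h; exact: (fintype.subsetP TK).
Qed.

Definition compatible T w := `[< red w /\ forall b, le_l (gen b) w -> b \notin T >].

Lemma head_set_avoid w T : red w -> (forall b, le_l (gen b) w -> b \notin T) ->
  head_set w `<=` avoid T.
Proof.
move=> rw wT xi h a aT axi.
by move: (wT a (head_set_max rw h (red_gen R l_label a) axi)); rewrite aT.
Qed.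

(** The sets [head_set w] are disjoint. *)
Lemma sum_heads_le T n :
  \sum_(w <- punctured_ball l n | compatible T w) p ^+ len w * m (avoid (follow w))
  <= m (avoid T).
Proof.
rewrite -big_filter; under eq_bigr do rewrite -mass_head_set.
apply: sum_mass_le.
- by rewrite filter_uniq // undup_uniq.
- exact: measurable_avoid.
- by move=> w; exact: measurable_avoid_at.
- move=> w; rewrite mem_filter => /andP[/asboolP[rw wT] _].
  exact: head_set_avoid.
- move=> w x xi; rewrite !mem_filter => /andP[/asboolP[rw _] _].
  by move=> /andP[/asboolP[rx _] _]; exact: head_set_inj.
Qed.

Lemma sum_sphere_le n :
  \sum_(w <- sphere l n | `[< red w >]) p ^+ n * m (avoid (follow w)) <= 1.
Proof.
rewrite -big_filter -mass_setT.
rewrite (eq_big_seq (fun w => m (head_set w))) => [|w]; last first.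
  by rewrite mem_filter mem_sphere mass_head_set => /andP[_ /eqP ->].
apply: sum_mass_le.
- by rewrite filter_uniq // undup_uniq.
- exact: measurableT.
- by move=> w; exact: measurable_avoid_at.
- by [].
- move=> w x xi; rewrite !mem_filter => /andP[/asboolP rw _].
  by move=> /andP[/asboolP rx _]; exact: head_set_inj.
Qed.

(** The sets [head_set w] cover all points but those with a reduced divisor of
    length [n]; the second sum is an error term, which tends to [0] as [n] grows
    in the situation of [parameter_le]. *)
Lemma avoid_le_sum T n :
  m (avoid T) <=
  \sum_(w <- punctured_ball l n | compatible T w) p ^+ len w * m (avoid (follow w))
  + \sum_(w <- sphere l n | `[< red w >]) p ^+ n.
Proof.
pose s1 := [seq w <- punctured_ball l n | compatible T w].
pose s2 := [seq w <- sphere l n | `[< red w >]].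
pose C (i : A + A) : set borel := match i with inl w => head_set w | inr w => up w end.
have -> : \sum_(w <- punctured_ball l n | compatible T w)
    p ^+ len w * m (avoid (follow w)) = \sum_(i <- map inl s1) m (C i).
  by rewrite big_map -[LHS]big_filter; apply: eq_bigr => w _; rewrite -mass_head_set.
have -> : \sum_(w <- sphere l n | `[< red w >]) p ^+ n = \sum_(i <- map inr s2) m (C i).
  rewrite big_map -[LHS]big_filter; apply: eq_big_seq => w.
  by rewrite mem_filter mem_sphere mass_up => /andP[_ /eqP ->].
rewrite -big_cat; apply: mass_le_sum.
- exact: measurable_avoid.
- by case=> w; [exact: measurable_avoid_at|exact: measurable_up].
move=> xi Txi; case: (head_set_exists xi n) => -[w [rw wn wxi]].
  exists (inr w) => //; rewrite mem_cat; apply/orP; right; apply: map_f.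
  by rewrite mem_filter mem_sphere wn eqxx andbT; apply/asboolP.
exists (inl w) => //; rewrite mem_cat; apply/orP; left; apply: map_f.
rewrite mem_filter mem_punctured_ball (ltnW wn) andbT; apply/andP; split.
  apply/asboolP; split=> // b bw; apply/negP => bT.
  by apply: (Txi b bT); apply: up_le bw _ _; case: wxi.
rewrite lt0n; apply/eqP => /at_length_eq0 w1.
by move: wxi; rewrite w1 head_set1.
Qed.

End Measure.

(** The comparison argument of Perron and Frobenius for the system
    [g T = \sum_w p ^ |w| * g (follow w)], where [g T] is the mass of [avoid T]: at a
    set [T0] that maximizes the ratio [c] of the masses [u] and [v], the system for
    [p1] gives [u T0 <= (p1 / p2) * c * v T0], up to an error that tends to [0]. *)
Lemma parameter_le (nu1 nu2 : {finite_measure set borel -> \bar R}) (p1 p2 : R) :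
  (0 < #|Sigma|)%N -> 0 < p1 -> 0 < p2 ->
  (forall x, nu1 (up x) = (p1 ^+ len x)%:E) ->
  (forall x, nu2 (up x) = (p2 ^+ len x)%:E) ->
  (forall T, T != full -> 0 < mass nu2 (avoid T)) ->
  p2 <= p1.
Proof.
move=> S0 p1_gt0 p2_gt0 h1 h2 pos; rewrite leNgt; apply/negP => p12.
pose u T := mass nu1 (avoid T); pose v T := mass nu2 (avoid T).
pose q := p1 / p2.
have q0 : 0 < q by rewrite divr_gt0.
have q1 : q < 1 by rewrite ltr_pdivrMr // mul1r.
have qE n : p1 ^+ n = q ^+ n * p2 ^+ n by rewrite -exprMn divfK // gt_eqF.
clearbody q.
have n0T : finset.set0 != full.
  by rewrite eq_sym -card_gt0 cardsT.
(* a common lower bound of the masses for [nu2], to control the error term *)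
have [de de0 deP] : exists2 de, 0 < de & forall T, T != full -> de <= v T.
  case: (@Order.TotalTheory.arg_minP _ _ _ finset.set0 (fun T => T != full) v n0T).
  by move=> T0 T0T minT; exists (v T0) => //; exact: pos.
pose r T := u T / v T.
case: (@Order.TotalTheory.arg_maxP _ _ _ finset.set0 (fun T => T != full) r n0T).
move=> T0 T0T maxT; set c := r T0 in maxT.
have uT : u full = 0 by exact: mass_avoid_setT.
have c1 : 1 <= c.
  have := maxT _ n0T; rewrite /r /u /v (mass_avoid_set0 h1) (mass_avoid_set0 h2).
  by rewrite divr1.
have c0 : 0 < c by apply: lt_le_trans c1.
have uc T : u T <= c * v T.
  have [->|TT] := eqVneq T full.
    by rewrite uT; apply: mulr_ge0; [exact: ltW|exact: mass_ge0].
  by rewrite -ler_pdivrMr; [exact: maxT|exact: pos].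
have uT0 : u T0 = c * v T0 by rewrite /c /r divfK // gt_eqF // pos.
clearbody c.
have bound n : (0 < n)%N -> c * (1 - q) * v T0 * de <= q ^+ n.
  move=> n0.
  have heads : \sum_(w <- punctured_ball l n | compatible T0 w)
      p1 ^+ len w * u (follow w) <= c * q * v T0.
    apply: (@le_trans _ _ (c * q * \sum_(w <- punctured_ball l n | compatible T0 w)
      p2 ^+ len w * v (follow w))); last first.
      by rewrite ler_pM2l ?mulr_gt0 //; exact: (sum_heads_le h2).
    rewrite mulr_sumr big_seq_cond [leRHS]big_seq_cond; apply: ler_sum => w.
    rewrite mem_punctured_ball => /andP[/andP[w0 _] _].
    have v0 : 0 <= v (follow w) by exact: mass_ge0.
    apply: (@le_trans _ _ (p1 ^+ len w * (c * v (follow w)))).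
      by rewrite ler_pM2l ?exprn_gt0.
    rewrite qE -(prednK w0) exprS.
    have := exprn_ile1 (len w).-1 (ltW q0) (ltW q1).
    have := exprn_gt0 (len w).-1.+1 p2_gt0.
    set y := p2 ^+ _; set z := q ^+ _ => y0 z1.
    rewrite -subr_ge0.
    have -> : c * q * (y * v (follow w)) - q * z * y * (c * v (follow w)) =
      (1 - z) * (c * q * y * v (follow w)) by ring.
    apply: mulr_ge0; first by rewrite subr_ge0.
    by apply: mulr_ge0 => //; apply: mulr_ge0; [apply: mulr_ge0|]; exact: ltW.
  have tail : (\sum_(w <- sphere l n | `[< red w >]) p1 ^+ n) * de <= q ^+ n.
    apply: (@le_trans _ _ (q ^+ n * \sum_(w <- sphere l n | `[< red w >])
        p2 ^+ n * v (follow w))); last first.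
      rewrite -[leRHS]mulr1 ler_pM2l ?exprn_gt0 //; exact: (sum_sphere_le h2).
    rewrite mulr_suml mulr_sumr big_seq_cond [leRHS]big_seq_cond.
    apply: ler_sum => w; rewrite mem_sphere => /andP[/eqP wn _].
    rewrite qE -mulrA ler_pM2l ?exprn_gt0 // ler_pM2l ?exprn_gt0 //.
    by apply: deP; apply: follow_neqT; rewrite wn.
  have := avoid_le_sum h1 T0 n; rewrite -/(u T0) uT0 => hu.
  have {}hu : c * (1 - q) * v T0 <= \sum_(w <- sphere l n | `[< red w >]) p1 ^+ n.
    rewrite -/u in heads; move: hu heads; rewrite /u; set s1 := \sum_(_ <- _ | _) _.
    set s2 := \sum_(_ <- _ | _) _; lra.
  by apply: le_trans tail; rewrite ler_pM2r.
pose e := c * (1 - q) * v T0 * de.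
have e0 : 0 < e by rewrite !mulr_gt0 ?subr_gt0 //; exact: pos.
have qcvg : q ^+ n @[n --> \oo] --> (0 : R).
  by apply: cvg_expr; rewrite ger0_norm // ltW.
have /cvgrPdist_lt /(_ _ e0) [N _ hN] := qcvg.
have := hN N.+1 (leqnSn N); rewrite /= sub0r normrN ger0_norm ?exprn_ge0 ?ltW //.
by rewrite ltNge (bound N.+1).
Qed.

End Uniform.

(** * Irreducible monoids have a connected Coxeter graph *)

Section Splitting.
Variables (Sigma : finType) (l : Sigma -> Sigma -> option nat).
Hypothesis l_label : artin_tits_label l.

Section Restriction.
Variable P : pred Sigma.

Definition restrict_label (a b : {x | P x}) : option nat := l (val a) (val b).

Lemma restrict_label_label : artin_tits_label restrict_label.
Proof.
split=> [a b|a b n]; first exact: l_label.1.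
exact: l_label.2.
Qed.

Definition restrict (u : seq Sigma) : seq {x | P x} := pmap insub u.

Lemma restrict_cat u v : restrict (u ++ v) = restrict u ++ restrict v.
Proof. exact: pmap_cat. Qed.

Lemma restrict_val (u : seq {x | P x}) : restrict (map val u) = u.
Proof. by rewrite /restrict map_pK //; exact: valK. Qed.

Lemma restrict_none (u : seq Sigma) : all (predC P) u -> restrict u = [::].
Proof.
by elim: u => //= a u IH /andP[/= Pa /IH]; rewrite /restrict /= insubN.
Qed.

Lemma val_restrict u : map val (restrict u) = seq.filter P u.
Proof.
rewrite /restrict pmap_filter; last exact: insubK.
by apply: eq_filter => a; rewrite /= isSome_insub.
Qed.

Lemma restrict_alt n (a b : Sigma) (Pa : P a) (Pb : P b) :
  restrict (alt n a b) = alt n (exist _ a Pa) (exist _ b Pb).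
Proof.
have -> : alt n a b = map val (alt n (exist _ a Pa) (exist _ b Pb)).
  by rewrite /alt /mkseq -map_comp; apply: eq_map => i /=; case: (odd i).
exact: restrict_val.
Qed.

Hypothesis P_split : forall a b, P a -> ~~ P b -> l a b = Some 2%N.

(** Erasing the letters outside [P] turns the commutation of a letter of [P] and a
    letter outside [P] into a trivial relation. *)
Lemma restrict_congr u v : braid_congr l u v ->
  braid_congr restrict_label (restrict u) (restrict v).
Proof.
elim=> [w|w1 w2 _|w1 w2 w3 _ h _|w1 w2 a b m ab lab].
- exact: braid_refl.
- exact: braid_sym.
- exact: braid_trans.
have m2 := l_label.2 _ _ _ lab.
rewrite !restrict_cat; case Pa: (P a); case Pb: (P b).
- by rewrite !restrict_alt; apply: braid_step.
- have mE : m = 2%N by move: lab; rewrite P_split ?Pb // => -[].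
  by rewrite mE !altS /restrict /= (insubT P Pa) /= insubN ?Pb //; exact: braid_refl.
- have mE : m = 2%N by move: lab; rewrite l_label.1 P_split ?Pa // => -[].
  by rewrite mE !altS /restrict /= (insubT P Pb) /= insubN ?Pa //; exact: braid_refl.
- rewrite !(@restrict_none (alt _ _ _)) ?all_alt //= ?Pa ?Pb //.
  exact: braid_refl.
Qed.

Lemma map_val_congr (u v : seq {x | P x}) : braid_congr restrict_label u v ->
  braid_congr l (map val u) (map val v).
Proof.
elim=> [w|w1 w2 _|w1 w2 w3 _ h _|w1 w2 a b m ab lab].
- exact: braid_refl.
- exact: braid_sym.
- exact: braid_trans.
have altE (c d : {x | P x}) : map val (alt m c d) = alt m (val c) (val d).
  by rewrite /alt /mkseq -map_comp; apply: eq_map => i /=; case: (odd i).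
by rewrite !map_cat !altE; apply: braid_step.
Qed.

Definition restr (x : artin_tits l) : artin_tits restrict_label :=
  \pi_(artin_tits restrict_label) (restrict (repr x)).

Lemma restr_pi u : restr (\pi_(artin_tits l) u) =
  \pi_(artin_tits restrict_label) (restrict u).
Proof. by apply/artin_tits_eqP/restrict_congr; exact: repr_pi_congr. Qed.

Lemma restrM x y : restr (x * y)%g = (restr x * restr y)%g.
Proof.
by rewrite -[x]reprK -[y]reprK -pi_cat !restr_pi restrict_cat -pi_cat.
Qed.

Definition incl (x : artin_tits restrict_label) : artin_tits l :=
  \pi_(artin_tits l) (map val (repr x)).

Lemma incl_pi u : incl (\pi_(artin_tits restrict_label) u) =
  \pi_(artin_tits l) (map val u).
Proof. by apply/artin_tits_eqP/map_val_congr; exact: repr_pi_congr. Qed.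

End Restriction.

Variable P : pred Sigma.
Hypothesis P_split : forall a b, P a -> ~~ P b -> l a b = Some 2%N.

Lemma sort_letters u :
  braid_congr l u (seq.filter P u ++ seq.filter (predC P) u).
Proof.
elim: u => [|a u IH]; first exact: braid_refl.
have step : braid_congr l (a :: u) (a :: (seq.filter P u ++ seq.filter (predC P) u)).
  by apply: (@braid_congr_cat _ _ [:: a] _ [:: a] _ _ IH); exact: braid_refl.
rewrite /=; case Pa: (P a) => //=.
apply: braid_trans step _.
have : all P (seq.filter P u) by exact: filter_all.
elim: (seq.filter P u) => [_|b w IHw /= /andP[Pb /IHw h]]; first exact: braid_refl.
have ab : a != b by apply/eqP => e; move: Pa; rewrite e Pb.
apply: (@braid_trans _ _ _ (b :: a :: w ++ seq.filter (predC P) u)).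
  have lab : l a b = Some 2%N by rewrite l_label.1 P_split // Pa.
  exact: (@braid_step _ l [::] (w ++ seq.filter (predC P) u) a b 2 ab lab).
by apply: (@braid_congr_cat _ _ [:: b] _ [:: b] _ _ h); exact: braid_refl.
Qed.

Let Q := predC P.
Let Q_split a b : Q a -> ~~ Q b -> l a b = Some 2%N.
Proof. by rewrite negbK => Qa Pb; rewrite l_label.1; exact: P_split. Qed.

Definition split_map (x : artin_tits l) :
    artin_tits (@restrict_label P) * artin_tits (@restrict_label Q) :=
  (restr P x, restr Q x).

Lemma split_mapM : {morph split_map : x y / (x * y)%g >-> (x * y)%g}.
Proof. by move=> x y; rewrite /split_map (restrM P_split) (restrM Q_split). Qed.

Lemma split_map1 : split_map 1%g = 1%g.
Proof. by rewrite /split_map -(pi_nil l) (restr_pi P_split) (restr_pi Q_split). Qed.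

Lemma split_map_bij : bijective split_map.
Proof.
exists (fun z => (incl z.1 * incl z.2)%g).
  move=> x; rewrite -[x]reprK /split_map (restr_pi P_split) (restr_pi Q_split) /=.
  rewrite !incl_pi -pi_cat !val_restrict.
  exact/artin_tits_eqP/braid_sym/sort_letters.
move=> [y z] /=; rewrite -[y]reprK -[z]reprK !incl_pi -pi_cat /split_map.
have nQ (w : seq {x | Q x}) : all (predC P) (map val w).
  by rewrite all_map; apply/allP => a _ /=; exact: (valP a).
have nP (w : seq {x | P x}) : all (predC Q) (map val w).
  by rewrite all_map; apply/allP => a _ /=; rewrite negbK; exact: (valP a).
rewrite (restr_pi P_split) (restr_pi Q_split) !restrict_cat !restrict_val.
by rewrite (restrict_none (nQ _)) (restrict_none (nP _)) cats0.
Qed.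

End Splitting.

Lemma irreducible_connected (Sigma : finType)
    (l : Sigma -> Sigma -> option nat) (K : {set Sigma}) :
  artin_tits_label l -> irreducible_artin_tits l ->
  K != finset.set0 -> K != [set: Sigma]%SET ->
  exists t s, [/\ t \in K, s \notin K & l t s <> Some 2%N].
Proof.
move=> l_label irr K0 KT; apply: contrapT => none; apply: irr.
have K_split a b : a \in K -> ~~ (b \in K) -> l a b = Some 2%N.
  by move=> aK bK; apply: contrapT => ab; apply: none; exists a, b.
pose P : pred Sigma := fun a => a \in K.
pose f := @split_map Sigma l P.
have fM : {morph f : x y / (x * y)%g >-> (x * y)%g} := @split_mapM Sigma l l_label P K_split.
pose fmul : {multiplicative _ -> _} :=
  HB.pack f (isMultiplicative.Build _ _ f fM).
exists {x | P x}, {x | predC P x}, _, _, fmul; split.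
- split; last exact: restrict_label_label.
  have /set0Pn[a aK] := K0.
  by apply/card_gt0P; exists (exist _ a aK).
- split; last exact: restrict_label_label.
  have [a aK] : exists a, a \notin K.
    apply: contrapT => h; move/eqP: KT; apply; apply/setP => a; rewrite inE.
    by apply/negPn/negP => aK; apply: h; exists a.
  by apply/card_gt0P; exists (exist _ a aK).
- exact: (@split_map1 Sigma l l_label P K_split).
- exact: (@split_map_bij Sigma l l_label P K_split).
Qed.

(** * Positivity of the masses *)

Section Positivity.
Variables (R : realType) (Sigma : finType) (l : Sigma -> Sigma -> option nat).
Hypothesis l_label : artin_tits_label l.
Variable x0 : boundary l.

Local Notation A := (artin_tits l).
Local Notation gen := (at_gen l).
Local Notation len x := (at_length x%g).
Local Notation borel := (borel_boundary x0).
Local Notation red := (@red R Sigma l).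
Local Notation full := [set: Sigma]%SET.
Implicit Types (x y z w q : A) (a b c s t : Sigma) (T K L : {set Sigma}) (xi : boundary l).

Variable nu : {finite_measure set borel -> \bar R}.

(** Almost every point then belongs to every [up x]. All generators divide each of
    its entries, which is therefore the Garside element: there is only one such
    point. *)
Lemma degenerate_of_full_mass : (forall x, nu (up x) = 1%:E) -> degenerate nu.
Proof.
move=> nu1.
have nuT : nu setT = 1%:E by rewrite -(up1 l) nu1.
have mT : mass nu setT = 1 by rewrite /mass nuT.
(* the union [N] of the [F n] consists of the points outside some [up x] *)
pose F n : set borel :=
  if unpickle n is Some u then ~` up (\pi_A u) else set0.
have mF n : measurable (F n).
  rewrite /F; case: unpickle => [u|]; last exact: measurable0.
  by apply: measurableC; exact: measurable_up.
pose N := \bigcup_n F n.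
have mN : measurable N by exact: bigcupT_measurable.
have nuN : nu N = 0%E.
  apply/(negligibleP _ mN); apply: negligible_bigcup => n.
  apply/(negligibleP _ (mF n)).
  suff F0 : mass nu (F n) = 0 by have := massE nu (mF n); rewrite F0.
  rewrite /F; case: unpickle => [u|]; last by rewrite mass0.
  rewrite massC; last exact: measurable_up.
  by rewrite mT /mass nu1 subrr.
have mN0 : mass nu N = 0 by rewrite /mass nuN.
have outN xi : ~ N xi -> forall x, up x xi.
  move=> Nxi x; apply: contrapT => nx; apply: Nxi.
  by exists (pickle (repr x)) => //; rewrite /F pickleK reprK.
have [xi Nxi] : exists xi, ~ N xi.
  apply: contrapT => h; have NT : N = setT.
    by apply/seteqP; split=> // xi _; apply: contrapT => nx; apply: h; exists xi.
  by move: nuN; rewrite NT nuT => -[] /eqP; rewrite oner_eq0.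
have Sgen a : smallest_garside (gen a).
  by have [h _ _] := smallest_garside_garside l; exact: h.
have gle (z : boundary l) i a : ~ N z -> le_l (gen a) (boundary_seq z i).
  by move=> Nz; apply: (up_pre_simple R l_label) => //; exact: outN.
have [|D [D1 D2 _]] := @finite_join R _ _ l_label [seq gen a | a <- enum Sigma]
    (boundary_seq xi 0).
  by move=> _ /mapP[a _ ->]; exact: gle.
have dD : is_delta D.
  split=> [_ [a _ <-]|z h].
    by apply: D1; apply: map_f; rewrite mem_enum.
  by apply: D2 => _ /mapP[a _ ->]; apply: h; exists a.
have const (z : boundary l) i : ~ N z -> boundary_seq z i = D.
  move=> Nz; apply: le_l_anti.
    by apply: (smallest_garside_le_delta R l_label dD); exact: boundary_simple.
  by apply: D2 => _ /mapP[a _ ->]; exact: gle.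
exists D, xi; split=> // [j|B mB]; first exact: const.
have eqxi (z : boundary l) : ~ N z -> z = xi.
  move=> Nz; apply: val_inj; apply/funext => i.
  by have := const z i Nz; rewrite -(const xi i Nxi).
rewrite diracE massE //; congr (_%:E).
have mBN : mass nu (B `&` N) = 0.
  apply/eqP; rewrite eq_le mass_ge0 andbT -mN0; apply: mass_le => //.
  exact: measurableI.
have -> : mass nu B = mass nu (B `\` N) by rewrite (mass_split nu mB mN) mBN add0r.
have [xiB|xiB] := boolP (xi \in B).
  rewrite (_ : B `\` N = ~` N) ?massC ?mT ?mN0 ?subr0 //.
  apply/seteqP; split=> z; first by case.
  by move=> Nz; split=> //; rewrite (eqxi z Nz); exact: set_mem.
rewrite (_ : B `\` N = set0) ?mass0 //.
apply/seteqP; split=> // z [Bz Nz]; move/negP: xiB; apply.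
by rewrite -(eqxi z Nz); exact: mem_set.
Qed.

Hypothesis l_irr : irreducible_artin_tits l.
Variable p : R.
Hypothesis p_gt0 : 0 < p.
Hypothesis nu_up : forall x, nu (up x) = (p ^+ len x)%:E.
Hypothesis nu_nondegenerate : ~ degenerate nu.

Local Notation m := (mass nu).

(** With positive mass, all the first letters are in [K]. *)
Definition positive K := 0 < m (avoid (finset.setC K)).

(** Non degeneracy enters here: at parameter [1] the measure would be the Dirac
    mass at the constant sequence of the Garside element. *)
Lemma parameter_lt1 : p < 1.
Proof.
rewrite lt_neqAle; apply/andP; split.
  apply/eqP => p1; apply/nu_nondegenerate/degenerate_of_full_mass => x.
  by rewrite nu_up p1 expr1n.
have [a _] := up_gen_cover x0.
have <- : m (up (gen a)) = p by rewrite (mass_up nu_up) at_length_gen.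
rewrite -(mass_setT nu_up); apply: mass_le => //; exact: measurable_up.
Qed.

Lemma positive_sub K L : K \subset L -> positive K -> positive L.
Proof.
move=> KL; rewrite /positive => h; apply: lt_le_trans h _.
by apply: (mass_avoid_sub nu); rewrite finset.setCS.
Qed.

Lemma positive_setT : positive full.
Proof. by rewrite /positive finset.setCT (mass_avoid_set0 nu_up). Qed.

Lemma positive_setC1 b : positive (finset.setC [set b]%SET).
Proof.
rewrite /positive finset.setCK.
have -> : avoid [set b]%SET = (~` up (gen b) : set borel).
  apply/seteqP; split=> xi; first by move=> h; apply: h; rewrite inE.
  by move=> h a; rewrite inE => /eqP ->.
rewrite massC; last exact: measurable_up.
by rewrite (mass_setT nu_up) (mass_up nu_up) at_length_gen expr1 subr_gt0 parameter_lt1.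
Qed.

Lemma positive0 : ~ positive finset.set0.
Proof. by rewrite /positive finset.setC0 mass_avoid_setT ltxx. Qed.

(** If no letter of [K] can follow [w], then in front of a point whose first letters
    are in [K], the element [w] is the largest reduced divisor, and so it decides
    which letters come first. *)
Lemma positive_step w K L : red w -> positive K ->
  (forall c, c \in K -> ~ red (w * gen c)%g) ->
  (forall b, le_l (gen b) w -> b \in L) -> positive L.
Proof.
move=> rw PK Kw Lw; rewrite /positive.
apply: (@lt_le_trans _ _ (m (head_set R w))).
  rewrite (mass_head_set l_label nu_up) mulr_gt0 ?exprn_gt0 //.
  apply: lt_le_trans PK _; apply: (mass_avoid_sub nu).
  apply/fintype.subsetP => a; rewrite !inE => /asboolP ra.
  by apply/negP => aK; exact: (Kw a aK (asboolW ra)).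
apply: mass_le; [exact: measurable_avoid_at|exact: measurable_avoid|].
apply: (head_set_avoid l_label) => // b /Lw bL.
by rewrite inE negbK.
Qed.

Definition minimal_positive K := positive K /\
  forall a, a \in K -> ~ positive (K :\ a)%SET.

(** By minimality, almost all points whose first letters are in [K] have all the
    letters of [K] as first letters. *)
Lemma minimal_positive_point K : minimal_positive K ->
  exists xi, forall a, a \in K -> up (gen a) xi.
Proof.
move=> [PK Kmin]; apply: contrapT => none.
have : m (avoid (finset.setC K)) <=
    \sum_(a <- enum K) m (avoid (finset.setC (K :\ a)%SET)).
  apply: (mass_le_sum nu (C := fun a => avoid (finset.setC (K :\ a)%SET))).
  - exact: measurable_avoid.
  - by move=> a; exact: measurable_avoid.
  move=> xi h; apply: contrapT => h'; apply: none; exists xi => a aK.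
  apply: contrapT => na; apply: h'; exists a; first by rewrite mem_enum.
  move=> b; rewrite !inE negb_and negbK => /orP[/eqP->//|bK].
  by apply: h; rewrite inE.
rewrite big_seq big1 => [|a].
  by move=> h; move: PK; rewrite /positive ltNge h.
rewrite mem_enum => /Kmin /negP; rewrite /positive -leNgt => h.
by apply/eqP; rewrite eq_le h mass_ge0.
Qed.

(** Apply [positive_step] to [s * d], where [d] is the least common multiple of [K]:
    its first letters are [s] and the letters of [K] that commute with [s]. A
    picture: tokens occupy the vertices of [K] in the Coxeter graph, and the
    neighbours of the hole [s] all slide to [s], where they merge. *)
Lemma positive_slide K s : minimal_positive K -> s \notin K ->
  positive (s |: [set b in K | l s b == Some 2%N])%SET.
Proof.
move=> Kmin sK; have [xi h] := minimal_positive_point Kmin.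
have [|z hz] := @up_finite _ _ [seq gen a | a <- enum K] xi.
  by move=> _ /mapP[a aK ->]; apply: h; rewrite mem_enum in aK.
have [|d [rd Kd dK]] := @delta_exists R _ _ l_label K z.
  by move=> a aK; apply: hz; apply: map_f; rewrite mem_enum.
apply: (@positive_step (gen s * d)%g K) => //.
- apply: (red_gen_mul l_label rd) => -[y dE].
  by move: Kd; rewrite dE => /(letters_inM l_label)[/(letters_in_gen l_label)]; rewrite (negPf sK).
- exact: Kmin.1.
- move=> c cK; rewrite -amulA => /(red_suffix l_label).
  exact: (not_red_right l_label rd Kd dK cK).
- move=> b /(descent_gen_mul R l_label sK Kd)[->|[bK lsb]].
    by rewrite !inE eqxx.
  by rewrite !inE bK lsb eqxx orbT.
Qed.



Definition card_minimal K := positive K /\ forall L, positive L -> (#|K| <= #|L|)%N.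

Lemma card_minimalW K : card_minimal K -> minimal_positive K.
Proof.
move=> [PK Kmin]; split=> // a aK /Kmin; rewrite leqNgt => /negP; apply.
by rewrite [X in (_ < X)%N](cardsD1 a) aK.
Qed.

(** With as few tokens as possible nothing can merge, so that exactly one token
    moves. *)
Lemma card_minimal_slide K s t : card_minimal K -> t \in K -> s \notin K ->
  l s t <> Some 2%N ->
  card_minimal (s |: (K :\ t))%SET /\
  forall b, b \in K -> b != t -> l s b = Some 2%N.
Proof.
move=> cK tK sK lst; have [PK Kmin] := cK.
have PK' := positive_slide (card_minimalW cK) sK; move: PK'.
set K' := (s |: _)%SET => PK'.
have cardE : #|(s |: (K :\ t))%SET| = #|K|.
  by rewrite cardsU1 (cardsD1 t K) tK !inE (negPf sK) andbF.
have sub : K' \subset (s |: (K :\ t))%SET.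
  apply/fintype.subsetP => b; rewrite !inE => /orP[->//|/andP[bK /eqP lsb]].
  by rewrite bK andbT; apply/orP; right; apply/eqP => bt; apply: lst; rewrite -bt.
have K'E : K' = (s |: (K :\ t))%SET.
  by apply/eqP; rewrite eqEcard sub cardE Kmin.
split; first by rewrite -K'E; split=> // L /Kmin; rewrite K'E cardE.
move=> b bK bt; have : b \in K' by rewrite K'E !inE bt bK orbT.
rewrite !inE => /orP[/eqP bs|/andP[_ /eqP//]].
by move: sK; rewrite -bs bK.
Qed.

(** Among the tokens that have a neighbouring token, some [a] is next to a hole
    [b]. Once it has moved to [b], the hole left at [a] is next to [b] and to the
    old neighbour of [a], and these two merge. *)
Lemma card_minimal_independent K t u : card_minimal K -> t \in K -> u \in K ->
  t != u -> l t u = Some 2%N.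
Proof.
move=> cK tK uK tu; apply: contrapT => ltu.
pose C := [set a in K | [exists b in K, (b != a) && (l a b != Some 2%N)]]%SET.
have C0 : C != finset.set0.
  apply/set0Pn; exists t; rewrite inE tK /=; apply/existsP; exists u.
  by rewrite uK eq_sym tu; apply/eqP.
have CT : C != full.
  have [_ /(_ _ (positive_setC1 t))] := cK.
  rewrite cardsC1; apply: contraTneq => CT.
  have -> : K = full.
    apply/setP => a; rewrite inE; have : a \in C by rewrite CT inE.
    by rewrite inE => /andP[].
  by rewrite cardsT -ltnNge prednK //; apply/card_gt0P; exists t.
have [a [b [aC bC lab]]] := irreducible_connected l_label l_irr C0 CT.
have ab : a != b by apply: contraTneq aC => ->.
move: aC; rewrite inE => /andP[aK /existsP[c /and3P[cK' ca /eqP lac]]].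
have bK : b \notin K.
  apply: contra bC => bK; rewrite inE bK /=; apply/existsP; exists a.
  by rewrite aK ab; apply/eqP; rewrite l_label.1.
have lba : l b a <> Some 2%N by rewrite l_label.1.
have [c1 h1] := card_minimal_slide cK aK bK lba.
have [||_ h2] := card_minimal_slide c1 _ _ lab.
- by rewrite !inE eqxx.
- by rewrite !inE eqxx (negPf ab).
apply: lac; apply: h2; first by rewrite !inE ca cK' orbT.
by apply: contraNneq bK => <-.
Qed.

Definition coxeter_edge : rel Sigma := fun a b => (a != b) && (l a b != Some 2%N).

Lemma coxeter_connected a b : connect coxeter_edge a b.
Proof.
pose C := [set c | connect coxeter_edge a c]%SET.
have [CT|CT] := eqVneq C full.
  have : b \in C by rewrite CT inE.
  by rewrite inE.
have C0 : C != finset.set0 by apply/set0Pn; exists a; rewrite inE connect0.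
have [t [s [tC sC lts]]] := irreducible_connected l_label l_irr C0 CT.
exfalso; apply: (negP sC); have := tC; rewrite !inE => at_.
apply: connect_trans at_ _; apply: connect1; rewrite /coxeter_edge.
apply/andP; split; last exact/eqP.
by apply: contraNneq sC => <-.
Qed.

(** Walking a token along a path towards another one would merge them. *)
Lemma card_minimal_no_path p' u v K : card_minimal K -> u \in K -> v \in K ->
  u != v -> path coxeter_edge u p' -> last u p' = v -> False.
Proof.
elim: p' u K => [|s p' IH] u K cK uK vK uv /=; first by move=> _ e; move: uv; rewrite e eqxx.
move=> /andP[/andP[us /eqP lus] sp] sv.
have [sK|sK] := boolP (s \in K).
  exact: lus (card_minimal_independent cK uK sK us).
have lsu : l s u <> Some 2%N by rewrite l_label.1.
have [c1 _] := card_minimal_slide cK uK sK lsu.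
apply: (IH s _ c1) => //; first by rewrite !inE eqxx.
  by rewrite !inE vK [v == u]eq_sym uv orbT.
by apply: contraNneq sK => ->.
Qed.

Lemma card_minimal_exists : exists K, card_minimal K.
Proof.
pose P : pred {set Sigma} := fun K => `[< positive K >].
have P0 : P full by apply/asboolP/positive_setT.
case: (@arg_minnP _ full P (fun K : {set Sigma} => #|K|) P0) => K /asboolP PK Kmin.
by exists K; split=> // L PL; apply/Kmin/asboolP.
Qed.

Lemma positive_some_set1 : exists t, positive [set t]%SET.
Proof.
have [K cK] := card_minimal_exists; have [PK _] := cK.
have [K0|/set0Pn[t tK]] := eqVneq K finset.set0.
  by case: positive0; rewrite -K0.
exists t; suff <- : K = [set t]%SET by [].
apply/setP => u; rewrite inE; apply/idP/eqP => [uK|->//].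
apply/eqP; apply: contraT => ut; exfalso.
have /connectP[p' h e] := coxeter_connected u t.
exact: (card_minimal_no_path cK uK tK ut h (esym e)).
Qed.

(** A single token can be moved to any vertex. *)
Lemma positive_set1 a : positive [set a]%SET.
Proof.
pose D := [set b | `[< positive [set b]%SET >]]%SET.
suff DT : D = full.
  have : a \in D by rewrite DT inE.
  by rewrite inE => /asboolP.
apply/eqP; apply: contraT => DT; exfalso.
have [t Pt] := positive_some_set1.
have D0 : D != finset.set0 by apply/set0Pn; exists t; rewrite inE; apply/asboolP.
have [b [s [bD sD lbs]]] := irreducible_connected l_label l_irr D0 DT.
have bs : s \notin [set b]%SET.
  by rewrite inE; apply: contraNneq sD => ->.
have Pb : positive [set b]%SET by move: bD; rewrite inE => /asboolP.
have bmin : minimal_positive [set b]%SET.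
  split=> // c; rewrite inE => /eqP ->; rewrite finset.setDv; exact: positive0.
have lsb : l s b <> Some 2%N by rewrite l_label.1.
move/negP: sD; apply; rewrite inE; apply/asboolP.
suff <- : (s |: [set c in [set b] | l s c == Some 2%N])%SET = [set s]%SET.
  exact: positive_slide.
apply/setP => c; rewrite !inE; case: (c =P s) => //= _.
by apply/negP => /andP[/eqP -> /eqP].
Qed.

Lemma mass_avoid_gt0 T : T != full -> 0 < m (avoid T).
Proof.
move=> TT; rewrite -[T]finset.setCK; apply/(@positive_sub (finset.setC T)) => //.
have [a aT] : exists a, a \notin T.
  apply: contrapT => h; move/eqP: TT; apply; apply/setP => a; rewrite inE.
  by apply/negPn/negP => aT; apply: h; exists a.
apply: positive_sub (positive_set1 a).
by apply/fintype.subsetP => b; rewrite !inE => /eqP ->.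
Qed.

End Positivity.

(** * Uniqueness of the uniform measure *)

Theorem theorem2p35 (R : realType) (Sigma : finType)
    (l : Sigma -> Sigma -> option nat)
    (Sigma_nonempty : (0 < #|Sigma|)%N) (l_label : artin_tits_label l)
    (l_irr : irreducible_artin_tits l) (x0 : boundary l)
    (nu1 nu2 : {finite_measure set (borel_boundary x0) -> \bar R})
    (nu1_unif : uniform_measure nu1) (nu2_unif : uniform_measure nu2)
    (B : set (borel_boundary x0)) (mB : measurable B) :
  nu1 B = nu2 B.
Proof.
have [_ nd1 [p1 p1_gt0 up1_]] := nu1_unif.
have [_ nd2 [p2 p2_gt0 up2_]] := nu2_unif.
have pE : p1 = p2.
  apply/eqP; rewrite eq_le; apply/andP; split.
    apply: (parameter_le l_label _ _ _ up2_ up1_) => // T.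
    exact: (mass_avoid_gt0 l_label l_irr p1_gt0).
  apply: (parameter_le l_label _ _ _ up1_ up2_) => // T.
  exact: (mass_avoid_gt0 l_label l_irr p2_gt0).
apply: (eq_measure_up l_label _ mB) => x.
by rewrite up1_ up2_ pE.
Qed.
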